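(* Let $J\subset\mathbb{R}$ be a bounded interval and let $X\subset J$ be a Borel subset such that $\mathrm{Cap}(X)=\mathrm{Cap}(J)$. Then for every subinterval $J'\subset J$ one has $\mathrm{Cap}(X\cap J')=\mathrm{Cap}(J')$.
   Context: For a compactly supported Borel measure $\mu$ on $\mathbb{C}$, its energy is $I(\mu):=\iint -\log|z-w|\,d\mu(z)\,d\mu(w)$ (possibly $+\infty$). For a bounded Borel set $X\subset\mathbb{C}$, let $\mathcal{P}(X)$ be the set of Borel probability measures supported on $X$ (i.e. $\mu(\mathbb{C}\setminus X)=0$); the logarithmic capacity of $X$ is $\mathrm{Cap}(X):=\exp(-\inf\{I(\mu)\mid \mu\in\mathcal{P}(X)\})$, with $\exp(-\infty)=0$ and $\inf\emptyset=+\infty$. *)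

(* Defs.v *)
From HB Require Import structures.
From mathcomp Require Import all_boot all_order all_algebra.
From mathcomp Require Import complex.
From mathcomp Require Import all_classical all_reals all_analysis.

Set Implicit Arguments.
Unset Strict Implicit.
Unset Printing Implicit Defensive.

Import Order.TTheory GRing.Theory Num.Theory.
Import numFieldNormedType.Exports.

Local Open Scope classical_set_scope.
Local Open Scope ring_scope.

(* R[i] with its Borel sigma-algebra; the topology is the one induced by the
   modulus, which the library attaches to the alias (R[i])^o. *)
Notation borelC R := (g_sigma_algebraType (@open (R[i])^o)).

(* [lne 0 = -oo], so the kernel is +oo on the diagonal. When mu is finite and
   compactly supported the kernel is bounded below (mu \x mu)-a.e., so that the
   iterated integral is the double integral and never meets oo - oo. *)
Definition log_energy (R : realType)
    (mu : {measure set (borelC R) -> \bar R}) : \bar R :=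
  (\int[mu]_w \int[mu]_z - lne (Normc.normc ((z : R[i]) - (w : R[i])))%:E)%E.

Definition prob_on (R : realType) (X : set R[i]) :
    set (probability (borelC R) R) :=
  [set mu | mu (~` X) = 0%E].

(* [expeR -oo = 0] and [ereal_inf set0 = +oo]. *)
Definition log_capacity (R : realType) (X : set R[i]) : \bar R :=
  expeR (- ereal_inf [set log_energy mu | mu in prob_on X])%E.

(* Main.v *)
Require Import Defs.
From HB Require Import structures.
From mathcomp Require Import all_boot all_order all_algebra.
From mathcomp Require Import complex.
From mathcomp Require Import all_classical all_reals all_analysis.
From mathcomp Require Import measurable_realfun ring lra.

Import Order.TTheory GRing.Theory Num.Theory.
Import numFieldNormedType.Exports.

Local Open Scope classical_set_scope.
Local Open Scope ring_scope.
Local Open Scope complex_scope.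

(** Why the theorem holds.  Let [J] have endpoints [c - h < c + h] and write a
    point of [J] as [x = c + h cos t].  Up to the additive constant [ln (2h)],
    the logarithmic kernel is
<<
      K(a, b) = - ln (|cos a - cos b| / 2)
              = ln 4 + sum over k >= 1 of (2 / k) cos (k a) cos (k b),
>>
    a nonnegative kernel which is diagonal in the cosine basis.  Hence the
    energy of a probability [mu] is [ln 4] plus the sum of [(2 / k) m_k ^ 2],
    where [m_k] is the integral of [cos (k t)].  The infimum over [J] is [ln 4],
    reached by the arcsine law, whose moments [m_k] all vanish, and a sequence
    [mu_n] on [X] whose energies tend to the infimum, which exists because
    [Cap X = Cap J], has all its moments tending to [0].

    Let now [nu] be a probability on [J'] with finite energy.  Its Fejer mean
    [f] is the trigonometric polynomial such that [f] times the arcsine law has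
    the moments [phi_k m_k(nu)], where [0 <= phi_k <= 1].  As the moments of
    [mu_n] tend to those of the arcsine law, the moments of [f mu_n] tend to
    [phi_k m_k(nu)] too, so that [f mu_n] has asymptotically at most the energy
    of [nu], provided the high frequencies of [f mu_n] are controlled.  They are,
    by a comparison: if [0 <= f <= M] and [H <= K] is a truncation of the series
    above, then integrating [(K - H)(M ^ 2 - f(x) f(y)) >= 0] against
    [mu_n x mu_n] bounds the energy of [f mu_n] by its [H]-energy, a polynomial
    in finitely many moments, plus [M ^ 2] times the difference between the
    energy and the [H]-energy of [mu_n], which is small because both are close
    to [ln 4] ([energy_reweighted_le]).

    It remains to cut [f mu_n] down to [J'] and to normalize it.  Cutting
    decreases the energy because [K >= 0], and costs little mass because the
    Fejer kernel is small away from its diagonal and [nu] is carried, up to a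
    small mass, by a compact subinterval of the interior of [J'].  The result is
    a probability on the intersection of [X] and [J'] whose energy is close to
    that of [nu] ([near_equilibrium_transfer]), so both capacities agree
    ([robin_subinterval_le]). *)

(** * Cosine expansion of the logarithmic kernel *)
Section log_kernel.
Context {R : realType}.
Implicit Types s t a b : R.

Lemma cos_nat_rec t n :
  cos (n.+2%:R * t) = 2 * cos t * cos (n.+1%:R * t) - cos (n%:R * t).
Proof.
have -> : n.+2%:R * t = n.+1%:R * t + t by rewrite -[n.+2]addn1 natrD mulrDl mul1r.
have -> : n%:R * t = n.+1%:R * t - t.
  by rewrite -[n.+1]addn1 natrD mulrDl mul1r addrK.
by rewrite cosD cosB; ring.
Qed.

(** Multiplying by the Poisson denominator turns the sum into the real part of
    a geometric series: this is what makes the derivative in [s] of the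
    remainder of the logarithmic series explicit. *)
Lemma cos_sum_telescope s t n :
  (1 - 2 * s * cos t + s ^+ 2) * (\sum_(k < n) s ^+ k * cos (k.+1%:R * t)) =
  cos t - s - s ^+ n * cos (n.+1%:R * t) + s ^+ n.+1 * cos (n%:R * t).
Proof.
elim: n => [|n IH].
  by rewrite big_ord0 mul0r cos0 expr0 expr1 !mul1r; ring.
by rewrite big_ord_recr/= mulrDr IH cos_nat_rec !exprS; ring.
Qed.

Lemma poisson_den_ge s t : 0 <= s < 1 -> (1 - s) ^+ 2 <= 1 - 2 * s * cos t + s ^+ 2.
Proof.
move=> /andP[s0 s1]; have := cos_le1 t => c1.
have : 0 <= s * (1 - cos t) by rewrite mulr_ge0// subr_ge0.
nra.
Qed.

(** Partial sum of the real part of [- log (1 - s exp (i t))]. *)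
Definition log_sum s t n : R := \sum_(k < n) s ^+ k.+1 / k.+1%:R * cos (k.+1%:R * t).

Let G t n s := log_sum s t n + 2^-1 * ln (1 - 2 * s * cos t + s ^+ 2).

Let is_derive_G t n s : 0 <= s < 1 ->
  is_derive s 1 (G t n) ((s ^+ n.+1 * cos (n%:R * t) - s ^+ n * cos (n.+1%:R * t))
    / (1 - 2 * s * cos t + s ^+ 2)).
Proof.
move=> s01; have den := poisson_den_ge s t s01.
have D0 : 0 < 1 - 2 * s * cos t + s ^+ 2.
  by apply: lt_le_trans den; case/andP: s01 => *; rewrite exprn_gt0// subr_gt0.
have H1 : is_derive s 1 (fun s => log_sum s t n)
    (\sum_(k < n) s ^+ k * cos (k.+1%:R * t)).
  have := @is_derive_sum _ _ _ n
    (fun k => (cos (k.+1%:R * t) / k.+1%:R) \*: (@id R) ^+ k.+1) s 1 _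
    (fun k => is_deriveZ (cos (k.+1%:R * t) / k.+1%:R)
                (is_deriveX k.+1 (is_derive_id s 1))).
  rewrite (_ : \sum_(i < n) _ = log_sum ^~ t ^~ n); last first.
    apply/funext => x; rewrite fct_sumE; apply: eq_bigr => k _.
    rewrite /= exprfctE /GRing.scale /=; ring.
  move/is_derive_eq; apply; apply: eq_bigr => k _.
  have k0 : k.+1%:R != 0 :> R by rewrite pnatr_eq0.
  by rewrite /GRing.scale /= mulr1 mulrA divfK// mulrC.
have H2 : is_derive s 1 (fun s => 1 - 2 * s * cos t + s ^+ 2) (- 2 * cos t + 2 * s).
  have := is_deriveD (is_deriveD (is_derive_cst (1 : R) s 1)
   (is_deriveZ (- 2 * cos t) (is_derive_id s 1))) (is_deriveX 2 (is_derive_id s 1)).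
  rewrite (_ : _ + _ = (fun s => 1 - 2 * s * cos t + s ^+ 2)); last first.
    by apply/funext => x; rewrite -[LHS]/(1 + (- 2 * cos t) * x + (id ^+ 2) x) exprfctE; ring.
  by move/is_derive_eq; apply; rewrite /GRing.scale /=; ring.
have H3 := is_derive1_comp (g := fun s => 1 - 2 * s * cos t + s ^+ 2)
  (is_derive1_ln D0) H2.
have := is_deriveD H1 (is_deriveZ 2^-1 H3).
move/is_derive_eq; apply.
rewrite /GRing.scale /= -[X in X + _](mulKf (lt0r_neq0 D0)) cos_sum_telescope.
rewrite !exprS; field.
by rewrite lt0r_neq0.
Qed.

(** The remainder vanishes at [s = 0] and has an explicit, small derivative in
    [s], so the mean value theorem bounds it with no appeal to infinite series.
    The bound is uniform in [t], and tends to [0] with [n] for fixed [s]. *)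
Lemma log_sum_bound s t n : 0 <= s < 1 ->
  `|log_sum s t n + 2^-1 * ln (1 - 2 * s * cos t + s ^+ 2)| <=
  2 * s ^+ n / (1 - s) ^+ 2.
Proof.
move=> /andP[s0 s1].
have dG x : x \in `]0, s[ -> is_derive x 1 (G t n) ((x ^+ n.+1 * cos (n%:R * t) - x ^+ n * cos (n.+1%:R * t))
    / (1 - 2 * x * cos t + x ^+ 2)).
  rewrite in_itv/= => /andP[x0 xs]; apply: is_derive_G.
  by rewrite ltW//= (lt_trans xs).
have cG : {within `[0, s], continuous (G t n)}.
  apply: derivable_within_continuous => x; rewrite in_itv/= => /andP[x0 xs].
  by have [] := @is_derive_G t n x _; rewrite ?x0 ?(le_lt_trans xs).
have [c + ] := MVT_segment s0 dG cG.
rewrite in_itv/= => /andP[c0 cs].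
have -> : G t n 0 = 0.
  rewrite /G /log_sum big1 ?add0r; last by move=> k _; rewrite expr0n/= mul0r mul0r.
  by rewrite mulr0 mul0r subr0 expr0n/= addr0 ln1 mulr0.
rewrite !subr0 -/(G t n s) => ->.
have c01 : 0 <= c < 1 by rewrite c0 (le_lt_trans cs).
have den := poisson_den_ge c t c01.
have s2 : 0 < (1 - s) ^+ 2 by rewrite exprn_gt0// subr_gt0.
have den' : (1 - s) ^+ 2 <= 1 - 2 * c * cos t + c ^+ 2.
  by apply: le_trans den; rewrite lerXn2r ?nnegrE; lra.
rewrite normrM (ger0_norm s0) normrM normfV [X in _ / X]ger0_norm; last first.
  by apply: le_trans den'; exact: ltW.
apply: (@le_trans _ _ (2 * s ^+ n / (1 - s) ^+ 2 * 1)); last by rewrite mulr1.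
apply: ler_pM => //; last exact: ltW.
  by rewrite mulr_ge0// invr_ge0; apply: le_trans den'; exact: ltW.
apply: ler_pM => //.
- by rewrite invr_ge0; apply: le_trans den'; exact: ltW.
- apply: (le_trans (ler_normB _ _)).
  rewrite mulrDl mul1r; apply: lerD; rewrite normrM ger0_norm ?exprn_ge0//.
    rewrite -[leRHS]mulr1 ler_pM ?exprn_ge0 ?cos_max// exprS.
    rewrite -[leRHS]mul1r ler_pM ?exprn_ge0//.
      by case/andP: c01 => _ /ltW.
    by rewrite lerXn2r ?nnegrE.
  rewrite -[leRHS]mulr1 ler_pM ?exprn_ge0 ?cos_max//.
  by rewrite lerXn2r ?nnegrE.
- rewrite lef_pV2 ?posrE//; exact: lt_le_trans den'.
Qed.

Definition cheb_sum s n a b : R :=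
  \sum_(k < n) 2 * (s ^+ k.+1 / k.+1%:R) * (cos (k.+1%:R * a) * cos (k.+1%:R * b)).

(** The Abel regularization with parameter [s] of [- ln (2 |cos a - cos b|)]. *)
Definition poisson_log s a b : R :=
  - (2^-1 * ln (1 - 2 * s * cos (a - b) + s ^+ 2)
   + 2^-1 * ln (1 - 2 * s * cos (a + b) + s ^+ 2)).

(** The logarithmic kernel in angular coordinates; dividing by [2], the diameter
    of the range of [cos], makes it nonnegative. *)
Definition logker a b : \bar R := (- lne (`|cos a - cos b| / 2)%:E)%E.

Lemma cheb_sumE s n a b : cheb_sum s n a b = log_sum s (a - b) n + log_sum s (a + b) n.
Proof.
rewrite -big_split; apply: eq_bigr => k _ /=.
rewrite mulrBr mulrDr cosB cosD; ring.
Qed.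

Lemma cheb_sum_poisson s n a b : 0 <= s < 1 ->
  `|cheb_sum s n a b - poisson_log s a b| <= 4 * s ^+ n / (1 - s) ^+ 2.
Proof.
move=> s01; rewrite cheb_sumE /poisson_log opprK addrACA.
apply: (le_trans (ler_normD _ _)).
have -> : 4 * s ^+ n / (1 - s) ^+ 2 =
  2 * s ^+ n / (1 - s) ^+ 2 + 2 * s ^+ n / (1 - s) ^+ 2 by rewrite -mulrDl -mulrDl -natrD.
by apply: lerD; exact: log_sum_bound.
Qed.

Lemma cos_dist_factor a b :
  (1 - cos (a - b)) * (1 - cos (a + b)) = (cos a - cos b) ^+ 2.
Proof.
rewrite cosB cosD.
transitivity ((1 - cos a * cos b) ^+ 2 - sin a ^+ 2 * sin b ^+ 2); first ring.
by rewrite !sin2cos2; ring.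
Qed.

(** Since [1 - 2 s cos t + s ^ 2 - 2 s (1 - cos t) = (1 - s) ^ 2 >= 0], the
    regularized kernel exceeds the kernel by at most [- ln s], everywhere.  This
    one-sided comparison is what later spares any domination argument. *)
Lemma poisson_log_le s a b : 0 < s < 1 -> cos a != cos b ->
  poisson_log s a b <= - ln (2 * `|cos a - cos b|) - ln s.
Proof.
move=> /andP[s0 s1] ab; rewrite /poisson_log -opprD lerN2 -mulrDr.
have s01 : 0 <= s < 1 by rewrite ltW.
have D0 t : 0 < 1 - 2 * s * cos t + s ^+ 2.
  by apply: lt_le_trans (poisson_den_ge s t s01); rewrite exprn_gt0// subr_gt0.
have c0 : 0 < `|cos a - cos b| by rewrite normr_gt0 subr_eq0.
have c2 : 0 < 2 * `|cos a - cos b| by rewrite mulr_gt0.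
have c3 : 0 < 2 * `|cos a - cos b| * s by rewrite mulr_gt0.
rewrite -!lnM ?posrE// [leRHS]mulrC.
rewrite ler_pdivlMr// mulr_natr -lnXn// ler_ln ?posrE ?exprn_gt0 ?mulr_gt0//.
have -> : (2 * `|cos a - cos b| * s) ^+ 2 = (2 * s * (1 - cos (a - b))) * (2 * s * (1 - cos (a + b))).
  rewrite [RHS]mulrACA cos_dist_factor !exprMn real_normK ?num_real//; ring.
have L t : 2 * s * (1 - cos t) <= 1 - 2 * s * cos t + s ^+ 2.
  rewrite -subr_ge0 (_ : _ - _ = (1 - s) ^+ 2) ?sqr_ge0//; ring.
have P t : 0 <= 2 * s * (1 - cos t).
  by rewrite mulr_ge0 ?mulr_ge0 ?subr_ge0 ?cos_le1// ltW.
by apply: ler_pM.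
Qed.

Lemma poisson_log_ge s a b : 0 <= s < 1 -> - ln 4 <= poisson_log s a b.
Proof.
move=> s01; rewrite lerN2.
have D0 t : 0 < 1 - 2 * s * cos t + s ^+ 2.
  apply: lt_le_trans (poisson_den_ge s t s01).
  by case/andP: s01 => _ s1; rewrite exprn_gt0// subr_gt0.
have D4 t : 1 - 2 * s * cos t + s ^+ 2 <= 4.
  have := cos_geN1 t; case/andP: s01 => s0 s1 c1.
  have : 0 <= s * (1 + cos t) by rewrite mulr_ge0// -lerBlDl sub0r.
  nra.
rewrite -mulrDr mulrC ler_pdivrMr// mulr_natr mulr2n.
by apply: lerD; rewrite ler_ln ?posrE.
Qed.

Lemma logkerE a b : cos a != cos b ->
  logker a b = (ln 4 - ln (2 * `|cos a - cos b|))%:E.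
Proof.
move=> ab; have c0 : 0 < `|cos a - cos b| by rewrite normr_gt0 subr_eq0.
rewrite /logker lne_EFin ?divr_gt0// -EFinN; congr EFin.
rewrite ln_div ?posrE// lnM ?posrE//.
have -> : 4 = 2 * 2 :> R by rewrite -natrM.
by rewrite lnM ?posrE//; ring.
Qed.

Lemma logker_diag a b : cos a = cos b -> logker a b = +oo%E.
Proof. by move=> ab; rewrite /logker ab subrr normr0 mul0r /= lexx. Qed.

Lemma logker_ge0 a b : (0 <= logker a b)%E.
Proof.
rewrite /logker oppe_ge0 lne_le0 lee_fin ler_pdivrMr// mul1r.
apply: (le_trans (ler_normB _ _)).
by apply: (le_trans (lerD (cos_max _) (cos_max _))).
Qed.

Lemma logker_minorant s n a b : 0 < s < 1 ->
  ((ln 4 + ln s - 4 * s ^+ n / (1 - s) ^+ 2 + cheb_sum s n a b)%:E <= logker a b)%E.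
Proof.
move=> /[dup] s01 /andP[s0 s1].
have [ab|ab] := eqVneq (cos a) (cos b); first by rewrite logker_diag// leey.
have := poisson_log_le _ _ _ s01 ab.
have := @cheb_sum_poisson s n a b; rewrite (ltW s0) s1 => /(_ isT).
rewrite ler_norml => /andP[_ h1] h2; rewrite logkerE// lee_fin.
lra.
Qed.

Definition cos_kernel (w : nat -> R) n a b : R :=
  \sum_(k < n) w k * (cos (k%:R * a) * cos (k%:R * b)).

(** A finite cosine kernel with almost all the constant term [ln 4], positive
    frequency weights bounded below independently of [e], and lying below the
    logarithmic kernel.  The lower bound on the weights is what controls each
    single moment of a measure of nearly minimal energy. *)
Lemma logker_cos_minorant e m : 0 < e -> exists n (w : nat -> R),
  [/\ (m < n)%N, (forall k, 0 <= w k.+1), ln 4 - e <= w 0%N,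
     (forall k, 2^-1 ^+ k / k.+1%:R <= w k.+1) &
     forall a b, ((cos_kernel w n a b)%:E <= logker a b)%E].
Proof.
move=> e0; pose s := Num.max 2^-1 (expR (- (e / 2))).
have s2 : 2^-1 <= s by rewrite le_max lexx.
have s0 : 0 < s by rewrite (lt_le_trans _ s2).
have s1 : s < 1.
  rewrite gt_max; apply/andP; split; first by rewrite invf_lt1// ltr1n.
  by rewrite -expR0 ltr_expR oppr_lt0 divr_gt0.
have lns : - (e / 2) <= ln s.
  by rewrite -[leLHS]expRK ler_ln ?posrE ?expR_gt0// le_max lexx orbT.
have s1' : 0 < (1 - s) ^+ 2 by rewrite exprn_gt0// subr_gt0.
have [n [mn sn]] : exists n, (m <= n)%N /\ 4 * s ^+ n / (1 - s) ^+ 2 <= e / 2.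
  have : s ^+ n @[n --> \oo] --> (0 : R) by apply: cvg_expr; rewrite gtr0_norm.
  (* The threshold is the one for which 4 s ^ n / (1 - s) ^ 2 < e / 2. *)
  move/cvgrPdist_lt => /(_ ((e / 2) * ((1 - s) ^+ 2 / 4))).
  have pp : 0 < (e / 2) * ((1 - s) ^+ 2 / 4) by apply: mulr_gt0; apply: divr_gt0.
  move=> /(_ pp)[N _ sN].
  exists (maxn m N); split; first exact: leq_maxl.
  have := sN (maxn m N) (leq_maxr _ _).
  rewrite sub0r normrN gtr0_norm ?exprn_gt0// => sN'.
  rewrite ler_pdivrMr// mulrC -ler_pdivlMr// -mulrA; exact: ltW.
exists n.+1, (fun k => if k is k'.+1 then 2 * (s ^+ k / k%:R) else
  ln 4 + ln s - 4 * s ^+ n / (1 - s) ^+ 2); split.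
- by rewrite ltnS.
- by move=> k; rewrite mulr_ge0// divr_ge0// exprn_ge0// ltW.
- lra.
- move=> k; rewrite mulrA ler_pM ?invr_ge0 ?exprn_ge0//.
  rewrite exprS mulrA -[leLHS]mul1r ler_pM ?exprn_ge0//.
    by rewrite -ler_pdivrMl// mulr1.
  by rewrite lerXn2r ?nnegrE// ltW.
- move=> a b; have := logker_minorant s n a b; rewrite s0 s1 => /(_ isT).
  apply: le_trans; rewrite lee_fin /cos_kernel big_ord_recl !mul0r !cos0 !mulr1.
  by rewrite lerD2l.
Qed.

Lemma cos_kernel_bound (w : nat -> R) n a b : `|cos_kernel w n a b| <= \sum_(k < n) `|w k|.
Proof.
apply: (le_trans (ler_norm_sum _ _ _)); apply: ler_sum => k _.
rewrite normrM -[leRHS]mulr1 ler_wpM2l//.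
by rewrite normrM -[leRHS]mulr1 ler_pM// cos_max.
Qed.

End log_kernel.

(** * The Fejer kernel in angular coordinates *)
Section fejer_kernel.
Context {R : realType}.
Implicit Types t a b : R.

(** Weights for which [cos_kernel] is the even part, in each variable, of the
    Fejer kernel of order [L]; the factor [2] accounts for the norm of
    [cos (k t)] when [k > 0]. *)
Definition fejer_coef L k : R := (if k == 0%N then 1 else 2) * ((L - k)%N%:R / L%:R).

(** [L] times the usual Fejer kernel of order [L]. *)
Definition fejer_fun L t : R := \sum_(k < L) (if k == 0%N :> nat then 1 else 2) * (L - k)%N%:R * cos (k%:R * t).

Let dirichlet t n : (1 - cos t) * (\sum_(k < n.+1) (if k == 0%N :> nat then 1 else 2) * cos (k%:R * t))
  = cos (n%:R * t) - cos (n.+1%:R * t).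
Proof.
elim: n => [|n IH].
  by rewrite big_ord_recl big_ord0 mul0r cos0 !mul1r addr0 mulr1.
by rewrite big_ord_recr mulrDr IH /= cos_nat_rec; ring.
Qed.

Lemma fejer_funE L t : (1 - cos t) * fejer_fun L t = 1 - cos (L%:R * t).
Proof.
elim: L => [|L IH]; first by rewrite /fejer_fun big_ord0 mul0r mulr0 cos0 subrr.
have -> : fejer_fun L.+1 t = fejer_fun L t +
   \sum_(k < L.+1) (if k == 0%N :> nat then 1 else 2) * cos (k%:R * t).
  have -> : fejer_fun L t = \sum_(k < L.+1) (if k == 0%N :> nat then 1 else 2) * (L - k)%N%:R * cos (k%:R * t).
    by rewrite big_ord_recr/= subnn mulr0 mul0r addr0.
  rewrite -big_split; apply: eq_bigr => k _.
  have kL : (k <= L)%N by rewrite -ltnS.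
  by rewrite /= (subSn kL) -natr1; ring.
by rewrite mulrDr IH dirichlet; ring.
Qed.

Lemma cos_nat_eq1 t : cos t = 1 -> forall n, cos (n%:R * t) = 1.
Proof.
move=> t1 n; suff [] : cos (n%:R * t) = 1 /\ cos (n.+1%:R * t) = 1 by [].
elim: n => [|n [IH1 IH2]]; first by rewrite mul0r cos0 mul1r.
by split=> //; rewrite cos_nat_rec IH1 IH2 t1; ring.
Qed.

Lemma fejer_fun_ge0 L t : 0 <= fejer_fun L t.
Proof.
have [t1|t1] := eqVneq (cos t) 1.
  apply: sumr_ge0 => k _; rewrite cos_nat_eq1// mulr1 mulr_ge0//.
  by case: ifP.
have c0 : 0 < 1 - cos t by rewrite subr_gt0 lt_neqAle t1 cos_le1.
by rewrite -(pmulr_rge0 _ c0) fejer_funE subr_ge0 cos_le1.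
Qed.

Lemma fejerE L a b : (0 < L)%N -> cos_kernel (fejer_coef L) L a b =
  (fejer_fun L (a - b) + fejer_fun L (a + b)) / (2 * L%:R).
Proof.
move=> L0; have L0' : L%:R != 0 :> R by rewrite pnatr_eq0 -lt0n.
rewrite /cos_kernel -big_split/= mulr_suml; apply: eq_bigr => k _.
rewrite mulrBr mulrDr cosB cosD /fejer_coef.
move: (if _ then _ else _) ((L - k)%N%:R) L0' => c d; move: (L%:R) => l l0.
by field.
Qed.

Lemma fejer_ge0 L a b : 0 <= cos_kernel (fejer_coef L) L a b.
Proof.
have [->|L0] := posnP L; first by rewrite /cos_kernel big_ord0.
rewrite fejerE// divr_ge0// ?addr_ge0 ?fejer_fun_ge0//.
Qed.

(** Both factors of [(1 - cos (a - b)) (1 - cos (a + b)) = (cos a - cos b) ^ 2]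
    are at most [2], so each is at least half the right-hand side; then
    [fejer_funE] bounds both Fejer sums. *)
Lemma fejer_off_diag L a b : cos a != cos b ->
  cos_kernel (fejer_coef L) L a b <= 4 / (L%:R * (cos a - cos b) ^+ 2).
Proof.
move=> ab; have [->|L0] := posnP L.
  by rewrite /cos_kernel big_ord0 mul0r invr0 mulr0.
have L0' : 0 < L%:R :> R by rewrite ltr0n.
have p0 : 0 < (cos a - cos b) ^+ 2 by rewrite exprn_even_gt0//= subr_eq0.
have pE := cos_dist_factor a b.
have B t t' : (1 - cos t) * (1 - cos t') = (cos a - cos b) ^+ 2 ->
    fejer_fun L t <= 4 / (cos a - cos b) ^+ 2.
  move=> tt'; rewrite ler_pdivlMr// -tt' mulrA [fejer_fun _ _ * _]mulrC fejer_funE.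
  have -> : 4 = 2 * 2 :> R by rewrite -natrM.
  have := cos_geN1 t'; have := cos_geN1 (L%:R * t).
  have := cos_le1 t'; have := cos_le1 (L%:R * t) => *.
  by apply: ler_pM; lra.
rewrite fejerE// ler_pdivrMr ?mulr_gt0//.
have -> : 4 / (L%:R * (cos a - cos b) ^+ 2) * (2 * L%:R) =
  4 / (cos a - cos b) ^+ 2 + 4 / (cos a - cos b) ^+ 2.
  move: p0 L0'; move: (_ ^+ 2) (L%:R) => p l p0 l0.
  by field; rewrite !gt_eqF.
by apply: lerD; [exact: (B _ (a + b))|apply: (B _ (a - b)); rewrite mulrC].
Qed.

End fejer_kernel.

(** * Probabilities with a density *)
Section density.
Context {d} {T : measurableType d} {R : realType}.
Variables (mu : probability T R) (g : T -> R).

(** The proofs are arguments so that the probability structure can be inferred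
    from the term itself. *)
Definition with_density of measurable_fun setT g & (forall x, 0 <= g x) &
    (\int[mu]_x (g x)%:E = 1)%E : set T -> \bar R :=
  fun A => (\int[mu]_(x in A) (g x)%:E)%E.

Hypothesis mg : measurable_fun setT g.
Hypothesis g0 : forall x, 0 <= g x.
Hypothesis g1 : (\int[mu]_x (g x)%:E = 1)%E.
Local Notation nu := (with_density mg g0 g1).

Let with_density0 : nu set0 = 0%E.
Proof. by rewrite /with_density integral_set0. Qed.

Let with_density_ge0 A : (0 <= nu A)%E.
Proof. by apply: integral_ge0 => x _; rewrite lee_fin. Qed.

Let with_density_sigma_additive : semi_sigma_additive nu.
Proof.
move=> /= F mF tF mUF; rewrite /with_density; apply: cvg_toP.
  apply: ereal_nondecreasing_is_cvgn => m n mn.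
  by apply: lee_sum_nneg_natr => // k _ _; exact: with_density_ge0.
rewrite ge0_integral_bigcup//=; last by move=> x _; rewrite lee_fin.
by apply/measurable_EFinP; exact: measurable_funTS.
Qed.

HB.instance Definition _ := isMeasure.Build _ _ _ nu
  with_density0 with_density_ge0 with_density_sigma_additive.

HB.instance Definition _ := Measure_isProbability.Build _ _ _ nu g1.

Lemma integral_with_density (h : T -> \bar R) :
  measurable_fun setT h -> (forall x, 0 <= h x)%E ->
  (\int[nu]_x h x = \int[mu]_x (h x * (g x)%:E))%E.
Proof.
move=> mh h0.
have dom : nu `<< mu.
  apply/null_content_dominatesP => A mA A0.
  rewrite /with_density; apply: null_set_integral => //.
  exact/measurable_funTS/measurable_EFinP.
rewrite -(Radon_Nikodym_SigmaFinite.change_of_variables dom)//.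
have mf := measurable_int _ (Radon_Nikodym_SigmaFinite.f_integrable dom).
have ig : mu.-integrable setT (EFin \o g).
  apply/integrableP; split; first exact/measurable_EFinP.
  under eq_integral do rewrite /= ger0_norm//.
  by rewrite g1 ltry.
apply: ge0_ae_eq_integral => //.
- exact: emeasurable_funM.
- by apply: emeasurable_funM => //; exact/measurable_EFinP.
- by move=> x _; rewrite mule_ge0// Radon_Nikodym_SigmaFinite.f_ge0.
- by move=> x _; rewrite mule_ge0// lee_fin.
apply: ae_eqe_mul2l => //.
apply: integral_ae_eq => //.
  exact: Radon_Nikodym_SigmaFinite.f_integrable.
  exact/measurable_EFinP.
by move=> A _ mA; rewrite -Radon_Nikodym_SigmaFinite.f_integral.
Qed.

End density.

(** * Double integrals *)
Lemma integral_probability_cst {d} {T : measurableType d} {R : realType}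
    (mu : probability T R) (r : R) : (\int[mu]_x r%:E = r%:E)%E.
Proof.
have := integral_cst mu measurableT r%:E.
by rewrite [X in (_ * X)%E](probability_setT mu) mule1; exact.
Qed.

Section double_integral.
Context {d} {T : measurableType d} {R : realType}.
Implicit Types (mu : probability T R) (F G : T -> T -> \bar R) (f g : T -> R).

Definition measurable2 F := measurable_fun setT (fun z : T * T => F z.1 z.2).

Definition dint mu F : \bar R := (\int[mu]_y \int[mu]_x F x y)%E.

Lemma measurable2_l F y : measurable2 F -> measurable_fun setT (F ^~ y).
Proof. by move=> mF; exact: (measurableT_comp mF (measurable_pair2 y)). Qed.

Lemma measurable2_int mu F : measurable2 F -> (forall x y, 0 <= F x y)%E ->
  measurable_fun setT (fun y => \int[mu]_x F x y)%E.
Proof.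
move=> mF F0; apply: (@measurable_fun_fubini_tonelli_G _ _ _ _ _ mu
  (fun z : T * T => F z.1 z.2)) => // z; exact: F0.
Qed.

(** Without a sign or an integrability assumption the inner integral is still
    measurable, being the difference of those of the positive and negative
    parts. *)
Lemma measurable2_integral mu F : measurable2 F ->
  measurable_fun setT (fun y => \int[mu]_x F x y)%E.
Proof.
move=> mF; under eq_fun do rewrite integralE.
apply: emeasurable_funB.
- under eq_fun => y do under eq_integral do rewrite funeposE.
  apply: (measurable2_int mu (fun x y => maxe (F x y) 0)).
    by apply: measurable_maxe.
  by move=> x y; rewrite le_max lexx orbT.
- under eq_fun => y do under eq_integral do rewrite funenegE.
  apply: (measurable2_int mu (fun x y => maxe (- F x y) 0)%E).
    by apply: measurable_maxe => //; exact: measurableT_comp.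
  by move=> x y; rewrite le_max lexx orbT.
Qed.

Lemma dintD mu F G : measurable2 F -> measurable2 G ->
  (forall x y, 0 <= F x y)%E -> (forall x y, 0 <= G x y)%E ->
  dint mu (fun x y => F x y + G x y)%E = (dint mu F + dint mu G)%E.
Proof.
move=> mF mG F0 G0; rewrite /dint -ge0_integralD//=.
- by apply: eq_integral => y _; rewrite ge0_integralD//; exact: measurable2_l.
- by move=> y _; exact: integral_ge0.
- exact: measurable2_int.
- by move=> y _; exact: integral_ge0.
- exact: measurable2_int.
Qed.

Lemma dint_le mu F G : measurable2 F -> measurable2 G ->
  (forall x y, 0 <= F x y)%E -> (forall x y, F x y <= G x y)%E ->
  (dint mu F <= dint mu G)%E.
Proof.
move=> mF mG F0 FG; have G0 x y : (0 <= G x y)%E by exact: le_trans (FG x y).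
apply: ge0_le_integral => //.
- by move=> y _; exact: integral_ge0.
- exact: measurable2_int.
- exact: measurable2_int.
- by move=> y _; apply: ge0_le_integral => //; exact: measurable2_l.
Qed.

Lemma dintZl mu F k : measurable2 F -> (forall x y, 0 <= F x y)%E -> 0 <= k ->
  dint mu (fun x y => k%:E * F x y)%E = (k%:E * dint mu F)%E.
Proof.
move=> mF F0 k0; rewrite /dint -ge0_integralZl_EFin//.
- by apply: eq_integral => y _; rewrite ge0_integralZl_EFin//; exact: measurable2_l.
- by move=> y _; exact: integral_ge0.
- exact: measurable2_int.
Qed.

Lemma dint_cst mu (C : R) : dint mu (fun _ _ => C%:E) = C%:E.
Proof.
rewrite /dint -[RHS](integral_probability_cst mu C).
by apply: eq_integral => y _; exact: integral_probability_cst.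
Qed.

Lemma dint_ge0 mu F : (forall x y, 0 <= F x y)%E -> (0 <= dint mu F)%E.
Proof. by move=> F0; apply: integral_ge0 => y _; exact: integral_ge0. Qed.

(** Bounded measurable functions are integrable for every probability. *)
Definition bmfun f := measurable_fun setT f /\ exists M, forall x, `|f x| <= M.

Lemma bmfun_int mu f : bmfun f -> mu.-integrable setT (EFin \o f).
Proof.
move=> [mf [M fM]]; apply: measurable_bounded_integrable => //.
  by apply: le_lt_trans (probability_le1 mu measurableT) _; rewrite ltry.
by exists M; split; [exact: num_real|move=> x Mx y _; exact: le_trans (fM y) (ltW Mx)].
Qed.

Lemma bmfunM f g : bmfun f -> bmfun g -> bmfun (fun x => f x * g x).
Proof.
move=> [mf [M fM]] [mg [N gN]]; split; first exact: measurable_funM.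
by exists (M * N) => x; rewrite normrM ler_pM.
Qed.

Lemma bmfun_cst c : bmfun (fun=> c).
Proof. by split; [exact: measurable_cst|exists `|c|]. Qed.

Lemma bmfunD f g : bmfun f -> bmfun g -> bmfun (fun x => f x + g x).
Proof.
move=> [mf [M fM]] [mg [N gN]]; split; first exact: measurable_funD.
by exists (M + N) => x; rewrite (le_trans (ler_normD _ _))// lerD.
Qed.

Lemma bmfun_sum n (p : nat -> T -> R) : (forall k, bmfun (p k)) ->
  bmfun (fun x => \sum_(k < n) p k x).
Proof.
move=> bp; elim: n => [|n IH].
  by under eq_fun do rewrite big_ord0; exact: bmfun_cst.
by under eq_fun do rewrite big_ord_recr/=; exact: bmfunD.
Qed.

Lemma integral_bmfun_sum mu n (c : nat -> R) (p : nat -> T -> R) C :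
  (forall k, bmfun (p k)) ->
  (\int[mu]_x (\sum_(k < n) c k * p k x + C)%:E =
   (\sum_(k < n) c k * (\int[mu]_x p k x)%R + C)%:E)%E.
Proof.
move=> bp; elim: n => [|n IH].
  rewrite big_ord0 add0r; under eq_integral do rewrite big_ord0 add0r.
  exact: integral_probability_cst.
rewrite big_ord_recr/= addrAC EFinD -IH.
under eq_integral do rewrite big_ord_recr/= addrAC EFinD.
have b1 : bmfun (fun x => \sum_(k < n) c k * p k x + C).
  apply: bmfunD; last exact: bmfun_cst.
  apply: (bmfun_sum n (fun k x => c k * p k x)) => k.
  by apply: bmfunM => //; exact: bmfun_cst.
have b2 : bmfun (fun x => c n * p n x) by apply: bmfunM => //; exact: bmfun_cst.
rewrite (integralD measurableT (bmfun_int _ _ b1) (bmfun_int _ _ b2)); congr (_ + _)%E.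
under eq_integral do rewrite /= EFinM.
rewrite integralZl//; last exact: bmfun_int.
by rewrite EFinM /Rintegral fineK//; apply: integrable_fin_num => //; exact: bmfun_int.
Qed.

Lemma dint_bmfun_sum mu n (c : nat -> R) (p : nat -> T -> R) C :
  (forall k, bmfun (p k)) ->
  dint mu (fun x y => (\sum_(k < n) c k * (p k x * p k y) + C)%:E) =
  (\sum_(k < n) c k * (\int[mu]_x p k x)%R ^+ 2 + C)%:E.
Proof.
move=> bp; rewrite /dint.
transitivity (\int[mu]_y (\sum_(k < n) (c k * (\int[mu]_x p k x)%R) * p k y + C)%:E)%E.
  apply: eq_integral => y _.
  under eq_integral do under eq_bigr do rewrite [p _ _ * p _ y]mulrC mulrA.
  rewrite (integral_bmfun_sum mu n (fun k => c k * p k y) p C bp).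
  by congr (_ + _)%:E; apply: eq_bigr => k _; rewrite mulrAC.
rewrite (integral_bmfun_sum mu n (fun k => c k * (\int[mu]_x p k x)%R) p C bp).
by congr (_ + _)%:E; apply: eq_bigr => k _; rewrite expr2 mulrA.
Qed.

End double_integral.

(** * Energies and cosine moments *)
Lemma measurable_lne_EFin {R : realType} : measurable_fun setT (fun r : R => lne r%:E).
Proof.
rewrite /lne; apply: measurable_fun_ifT => //=.
- by apply: measurable_fun_ler.
- by apply/measurable_EFinP; exact: measurable_ln.
Qed.

Section energy.
Context {d} {T : measurableType d} {R : realType}.
Variable th : T -> R.
Hypothesis mth : measurable_fun setT (fun x => cos (th x)).
Implicit Types (mu : probability T R) (f : T -> R) (w : nat -> R).

Definition cos_mode k x : R := cos (k%:R * th x).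

Definition cos_moment mu f k : R := (\int[mu]_x (cos_mode k x * f x))%R.

(** Energy of the measure with density [f] with respect to [mu]. *)
Definition energy mu f : \bar R :=
  dint mu (fun x y => (logker (th x) (th y) * (f x * f y)%:E)%E).

(** [cos (k th)] is a polynomial in [cos th], which is why only [cos th], and not
    [th] itself, has to be measurable. *)
Lemma bmfun_cos_mode k : bmfun (cos_mode k).
Proof.
split; last by exists 1 => x; exact: cos_max.
suff [] : measurable_fun setT (cos_mode k) /\ measurable_fun setT (cos_mode k.+1) by [].
elim: k => [|k [IH1 IH2]].
  split; rewrite /cos_mode; last by under eq_fun do rewrite mul1r.
  by under eq_fun do rewrite mul0r cos0; exact: measurable_cst.
split=> //; rewrite /cos_mode; under eq_fun do rewrite cos_nat_rec.
apply: measurable_funB => //; apply: measurable_funM => //.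
by apply: measurable_funM.
Qed.

Lemma measurable2_logker : measurable2 (fun x y => logker (th x) (th y)).
Proof.
rewrite /measurable2 /logker; apply: measurableT_comp => //.
apply: (measurableT_comp measurable_lne_EFin).
apply: measurable_funM => //; apply: measurableT_comp => //.
by apply: measurable_funB; exact: (measurableT_comp mth).
Qed.

Lemma measurable2_prod f : measurable_fun setT f -> measurable2 (fun x y => (f x * f y)%:E).
Proof.
move=> mf; apply/measurable_EFinP.
by apply: measurable_funM; exact: (measurableT_comp mf).
Qed.

Lemma measurable2_logkerM f : measurable_fun setT f ->
  measurable2 (fun x y => (logker (th x) (th y) * (f x * f y)%:E)%E).
Proof.
move=> mf; apply: emeasurable_funM; first exact: measurable2_logker.
exact: measurable2_prod.
Qed.

Lemma dint_cos_kernel mu w n f C : bmfun f ->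
  dint mu (fun x y => (cos_kernel w n (th x) (th y) * (f x * f y) + C)%:E) =
  (\sum_(k < n) w k * cos_moment mu f k ^+ 2 + C)%:E.
Proof.
move=> bf; rewrite -(dint_bmfun_sum mu n w (fun k x => cos_mode k x * f x)).
  apply: eq_integral => y _; apply: eq_integral => x _; congr (_ + _)%:E.
  rewrite mulr_suml; apply: eq_bigr => k _; rewrite /cos_mode; ring.
by move=> k; apply: bmfunM => //; exact: bmfun_cos_mode.
Qed.

Lemma measurable2_cos_kernel w n f C : measurable_fun setT f ->
  measurable2 (fun x y => (cos_kernel w n (th x) (th y) * (f x * f y) + C)%:E).
Proof.
move=> mf; apply/measurable_EFinP; apply: measurable_funD => //.
apply: measurable_funM; last by apply/measurable_EFinP; exact: measurable2_prod.
rewrite /cos_kernel; elim: n => [|n IH].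
  by under eq_fun do rewrite big_ord0; exact: measurable_cst.
under eq_fun do rewrite big_ord_recr/=; apply: measurable_funD => //.
have [mc _] := bmfun_cos_mode n.
apply: measurable_funM => //; apply: measurable_funM.
  exact: (measurableT_comp mc).
exact: (measurableT_comp mc).
Qed.

Variables (w : nat -> R) (n : nat).
Hypothesis w_minorant : forall a b, ((cos_kernel w n a b)%:E <= logker a b)%E.

Let cos_kernelM_ge0 f M x y : (forall x, 0 <= f x <= M) ->
  0 <= cos_kernel w n (th x) (th y) * (f x * f y) + (\sum_(k < n) `|w k|) * M ^+ 2.
Proof.
move=> fM; have /andP[fx0 fxM] := fM x; have /andP[fy0 fyM] := fM y.
rewrite -lerBlDr sub0r -lerNl.
apply: (le_trans (ler_norm _)); rewrite normrN normrM.
rewrite ler_pM// ?cos_kernel_bound// normrM !ger0_norm// expr2.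
by apply: ler_pM.
Qed.

(** The integral of [H f f] is the weighted sum of the squared moments, for the
    minorant [H].  As [H f f] changes sign, a constant [C >= |H f f|] is added
    to both integrands so that only nonnegative functions are integrated. *)
Lemma energy_ge_moments mu f M : measurable_fun setT f -> (forall x, 0 <= f x <= M) ->
  ((\sum_(k < n) w k * cos_moment mu f k ^+ 2)%:E <= energy mu f)%E.
Proof.
move=> mf fM; have bf : bmfun f.
  split=> //; exists M => x; have /andP[f0 ?] := fM x; by rewrite ger0_norm.
pose C := (\sum_(k < n) `|w k|) * M ^+ 2.
have C0 : 0 <= C by rewrite mulr_ge0 ?sqr_ge0 ?sumr_ge0.
have K0 x y : (0 <= logker (th x) (th y) * (f x * f y)%:E)%E.
  rewrite mule_ge0 ?logker_ge0// lee_fin.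
  by have /andP[? _] := fM x; have /andP[? _] := fM y; rewrite mulr_ge0.
rewrite -(@leeD2rE _ C%:E)// -EFinD -dint_cos_kernel//.
rewrite -[C%:E in leRHS](dint_cst mu).
have C0' (x y : T) : (0 <= C%:E)%E by rewrite lee_fin.
have E1 := dintD mu _ (fun _ _ => C%:E) (measurable2_logkerM f mf) (measurable_cst _) K0 C0'.
rewrite /energy -E1.
apply: dint_le.
- exact: measurable2_cos_kernel.
- apply: emeasurable_funD; last exact: measurable_cst.
  exact: measurable2_logkerM.
- by move=> x y; rewrite lee_fin cos_kernelM_ge0.
- move=> x y; rewrite EFinD leeD2r// EFinM lee_wpmul2r//.
  rewrite lee_fin; have /andP[? _] := fM x; have /andP[? _] := fM y.
  by rewrite mulr_ge0.
Qed.

(** This is [(K - H) (M ^ 2 - f(x) f(y)) >= 0] integrated, with [H] the minorant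
    of [K].  When [mu] nearly minimizes the energy, the two terms with the
    factor [M ^ 2] nearly cancel, so that the energy of [f mu] is governed by
    its [H]-energy. *)
Lemma energy_reweighted_le mu f M : measurable_fun setT f -> 0 < M ->
  (forall x, 0 <= f x <= M) ->
  (energy mu f + (M ^+ 2 * \sum_(k < n) w k * cos_moment mu (fun=> 1) k ^+ 2)%:E <=
   (M ^+ 2)%:E * energy mu (fun=> 1%R) + (\sum_(k < n) w k * cos_moment mu f k ^+ 2)%:E)%E.
Proof.
move=> mf M0 fM; have bf : bmfun f.
  split=> //; exists M => x; have /andP[f0 ?] := fM x; by rewrite ger0_norm.
have f0 x : 0 <= f x by have /andP[] := fM x.
have M20 : 0 <= M ^+ 2 by rewrite sqr_ge0.
pose C := (\sum_(k < n) `|w k|) * M ^+ 2.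
have ff0 x y : 0 <= f x * f y by rewrite mulr_ge0.
have K0 x y : (0 <= logker (th x) (th y) * (f x * f y)%:E)%E.
  by rewrite mule_ge0 ?logker_ge0// lee_fin.
have K1 x y : (0 <= logker (th x) (th y) * (1 * 1)%:E)%E.
  by rewrite mule_ge0 ?logker_ge0// lee_fin mul1r.
have dM : dint mu (fun x y => (cos_kernel w n (th x) (th y) * (M * M) + C)%:E) =
    (M ^+ 2 * \sum_(k < n) w k * cos_moment mu (fun=> 1) k ^+ 2 + C)%:E.
  rewrite (dint_cos_kernel mu w n (fun=> M) C (bmfun_cst M)) mulr_sumr.
  congr (_ + _)%:E; apply: eq_bigr => k _.
  rewrite [RHS]mulrCA -exprMn; congr (_ * _ ^+ 2).
  rewrite /cos_moment -RintegralZl//; last first.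
    by apply: bmfun_int; apply: bmfunM; [exact: bmfun_cos_mode|exact: bmfun_cst].
  by apply: eq_Rintegral => x _; rewrite mulr1 mulrC.
have mk1 := measurable2_logkerM (fun=> 1) (measurable_cst _).
have mkf := measurable2_logkerM f mf.
have mcM := measurable2_cos_kernel w n (fun=> M) C (measurable_cst _).
have mcf := measurable2_cos_kernel w n f C mf.
have c0 x y := cos_kernelM_ge0 f M x y fM.
have cM x y : 0 <= cos_kernel w n (th x) (th y) * (M * M) + C.
  by apply: (cos_kernelM_ge0 (fun=> M) M x y) => _; rewrite lexx ltW.
have key : (energy mu f +
    dint mu (fun x y => (cos_kernel w n (th x) (th y) * (M * M) + C)%:E) <=
    (M ^+ 2)%:E * energy mu (fun=> 1%R) +
    dint mu (fun x y => (cos_kernel w n (th x) (th y) * (f x * f y) + C)%:E))%E.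
  have mk1' : measurable2 (fun x y => ((M ^+ 2)%:E * (logker (th x) (th y) * (1 * 1)%:E))%E).
    exact: emeasurable_funM.
  have K1' x y : (0 <= (M ^+ 2)%:E * (logker (th x) (th y) * (1 * 1)%:E))%E.
    by rewrite mule_ge0.
  have E1 := dintD mu _ _ mkf mcM K0 cM; have E2 := dintZl mu _ _ mk1 K1 M20.
  have E3 := dintD mu _ _ mk1' mcf K1' c0.
  rewrite /energy -E1 -E2 -E3.
  apply: dint_le.
  - exact: emeasurable_funD.
  - exact: emeasurable_funD.
  - by move=> x y; rewrite adde_ge0// lee_fin.
  - move=> x y; have := w_minorant (th x) (th y).
    have := logker_ge0 (th x) (th y).
    case: (logker (th x) (th y)) => [r _|_ _|//]; last first.
      by rewrite mul1r mule1 gt0_muley ?lte_fin ?exprn_gt0// addye// leey.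
    rewrite lee_fin mul1r mule1 -!EFinM -!EFinD lee_fin => cr.
    have ffM : f x * f y <= M ^+ 2.
      have /andP[? ?] := fM x; have /andP[? ?] := fM y.
      by rewrite expr2; apply: ler_pM.
    have : 0 <= (r - cos_kernel w n (th x) (th y)) * (M ^+ 2 - f x * f y).
      by rewrite mulr_ge0// subr_ge0.
    nra.
move: key; rewrite dM dint_cos_kernel//.
move: (energy mu f) (energy mu _) => A B.
by rewrite !EFinD !addeA leeD2rE.
Qed.

End energy.

Section moments.
Context {d} {T : measurableType d} {R : realType}.
Variable th : T -> R.
Hypothesis mth : measurable_fun setT (fun x => cos (th x)).
Implicit Types (mu nu : probability T R) (f g : T -> R) (A : set T).

(** The kernel being nonnegative, restricting a density can only decrease the
    energy. *)
Lemma energy_le_scaled mu f g (c : R) : measurable_fun setT f -> measurable_fun setT g ->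
  0 <= c -> (forall x, 0 <= f x) -> (forall x, 0 <= g x <= c * f x) ->
  (energy th mu g <= (c ^+ 2)%:E * energy th mu f)%E.
Proof.
move=> mf mg c0 f0 gf; rewrite /energy.
have mkf := measurable2_logkerM th mth f mf.
have K0 x y : (0 <= logker (th x) (th y) * (f x * f y)%:E)%E.
  by rewrite mule_ge0 ?logker_ge0// lee_fin mulr_ge0.
have c20 : 0 <= c ^+ 2 by rewrite sqr_ge0.
rewrite -(dintZl mu _ _ mkf K0 c20).
apply: dint_le.
- exact: measurable2_logkerM.
- exact: emeasurable_funM.
- move=> x y; have /andP[? _] := gf x; have /andP[? _] := gf y.
  by rewrite mule_ge0 ?logker_ge0// lee_fin mulr_ge0.
- move=> x y; have /andP[? ?] := gf x; have /andP[? ?] := gf y.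
  rewrite muleCA -EFinM lee_wpmul2l ?logker_ge0// lee_fin.
  by rewrite expr2 mulrACA; apply: ler_pM.
Qed.

Lemma energy_with_density mu g (nu : probability T R) :
  measurable_fun setT g -> (forall x, 0 <= g x) ->
  (forall h, measurable_fun setT h -> (forall x, 0 <= h x)%E ->
    \int[nu]_x h x = \int[mu]_x (h x * (g x)%:E))%E ->
  energy th nu (fun=> 1) = energy th mu g.
Proof.
move=> mg g0 nuE; rewrite /energy /dint.
have mk : measurable2 (fun x y => (logker (th x) (th y) * (1 * 1)%:E)%E).
  exact: (measurable2_logkerM th mth (fun=> 1) (measurable_cst _)).
have K0 x y : (0 <= logker (th x) (th y) * (1 * 1)%:E)%E.
  by rewrite mule_ge0 ?logker_ge0// lee_fin mulr1.
rewrite nuE; first last.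
- by move=> y; exact: integral_ge0.
- exact: measurable2_int.
apply: eq_integral => y _.
rewrite (nuE _ (measurable2_l _ y mk) (K0 ^~ y)).
rewrite -ge0_integralZr//; first last.
- by rewrite lee_fin.
- by move=> x _; rewrite mule_ge0// lee_fin.
- apply: emeasurable_funM; last exact/measurable_EFinP.
  by apply: (measurable2_l _ y mk).
by apply: eq_integral => x _; rewrite mulr1 mule1 -muleA -EFinM.
Qed.

Lemma exists_with_density mu g : measurable_fun setT g -> (forall x, 0 <= g x) ->
  (\int[mu]_x (g x)%:E = 1)%E -> exists nu : probability T R,
  [/\ (forall A, measurable A -> mu A = 0 -> nu A = 0)%E,
    (forall A, measurable A -> (forall x, A x -> g x = 0) -> nu A = 0%E) &
    energy th nu (fun=> 1) = energy th mu g].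
Proof.
move=> mg g0 g1.
exists (with_density mu g mg g0 g1); split.
- move=> A mA A0; apply: null_set_integral => //.
  exact/measurable_funTS/measurable_EFinP.
- move=> A mA gA; rewrite -[LHS]/(\int[mu]_(x in A) (g x)%:E)%E.
  by apply: integral0_eq => x /gA ->.
- apply: energy_with_density => // h mh h0; exact: integral_with_density.
Qed.

End moments.

Lemma cvg_sum_ord {R : realType} n (u : nat -> nat -> R) (l : nat -> R) :
  (forall k, u k m @[m --> \oo] --> l k) ->
  \sum_(k < n) u k m @[m --> \oo] --> \sum_(k < n) l k.
Proof.
move=> ul; elim: n => [|n IH].
  by under eq_fun do rewrite big_ord0; rewrite big_ord0; exact: cvg_cst.
by under eq_fun do rewrite big_ord_recr; rewrite big_ord_recr; exact: cvgD.
Qed.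

(** * Fejer means and transfer of measures of nearly minimal energy *)
Section smoothing.
Context {d} {T : measurableType d} {R : realType}.
Variable th : T -> R.
Hypothesis mth : measurable_fun setT (fun x => cos (th x)).
Implicit Types (mu nu : probability T R) (f g : T -> R) (A : set T).

(** Density with respect to the arcsine law of the Fejer mean of [f nu]. *)
Definition fejer_smooth nu f L x : R :=
  \sum_(k < L) fejer_coef L k * cos_moment th nu f k * cos_mode th k x.

Lemma fejer_smoothE nu f L x : bmfun f ->
  (fejer_smooth nu f L x)%:E =
  (\int[nu]_y (cos_kernel (fejer_coef L) L (th x) (th y) * f y)%:E)%E.
Proof.
move=> bf; rewrite /fejer_smooth.
have := integral_bmfun_sum nu L (fun k => fejer_coef L k * cos_mode th k x)
  (fun k y => cos_mode th k y * f y) 0.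
rewrite addr0 => H; rewrite (_ : \sum_(_ < _) _ =
  \sum_(k < L) fejer_coef L k * cos_mode th k x * cos_moment th nu f k); last first.
  by apply: eq_bigr => k _; rewrite mulrAC.
rewrite -H; last by move=> k; apply: bmfunM => //; exact: bmfun_cos_mode.
apply: eq_integral => y _; rewrite addr0 /cos_kernel mulr_suml.
by congr EFin; apply: eq_bigr => k _; rewrite /cos_mode; ring.
Qed.

Lemma bmfun_fejer_smooth nu f L : bmfun (fejer_smooth nu f L).
Proof.
apply: (bmfun_sum L (fun k x => fejer_coef L k * cos_moment th nu f k * cos_mode th k x)) => k.
by apply: bmfunM; [exact: bmfun_cst|exact: bmfun_cos_mode].
Qed.

Lemma fejer_smooth_ge0 nu f L x : bmfun f -> (forall x, 0 <= f x) ->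
  0 <= fejer_smooth nu f L x.
Proof.
move=> bf f0; rewrite -lee_fin fejer_smoothE//; apply: integral_ge0 => y _.
by rewrite lee_fin mulr_ge0// fejer_ge0.
Qed.

Lemma fejer_smooth_le nu f L x : fejer_smooth nu f L x <=
  \sum_(k < L) `|fejer_coef L k * cos_moment th nu f k|.
Proof.
apply: (le_trans (ler_norm _)); apply: (le_trans (ler_norm_sum _ _ _)).
apply: ler_sum => k _; rewrite normrM -[leRHS]mulr1 ler_wpM2l//.
exact: cos_max.
Qed.

Lemma measurable_cos_kernel w n x : measurable_fun setT
  (fun y => cos_kernel w n (th x) (th y)).
Proof.
have [] : bmfun (fun y => \sum_(k < n) w k * (cos_mode th k x * cos_mode th k y)) => //.
apply: (bmfun_sum n (fun k y => w k * (cos_mode th k x * cos_mode th k y))) => k.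
apply: bmfunM; first exact: bmfun_cst.
by apply: bmfunM; [exact: bmfun_cst|exact: bmfun_cos_mode].
Qed.

Lemma fejer_smooth_off nu A L x (delta : R) : measurable A -> 0 < delta ->
  (forall y, A y -> delta <= `|cos (th x) - cos (th y)|) ->
  fejer_smooth nu \1_A L x <= 4 / (L%:R * delta ^+ 2).
Proof.
move=> mA d0 xA; rewrite -lee_fin fejer_smoothE; last first.
  by split; [exact: measurable_indic|exists 1 => y; rewrite ger0_norm ?indic_le1].
have c0 : 0 <= 4 / (L%:R * delta ^+ 2) by rewrite divr_ge0// mulr_ge0// sqr_ge0.
rewrite -[leRHS](integral_probability_cst nu).
apply: ge0_le_integral => //.
- by move=> y _; rewrite lee_fin mulr_ge0// fejer_ge0.
- apply/measurable_EFinP; apply: measurable_funM; last exact: measurable_indic.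
  exact: measurable_cos_kernel.
move=> y _; rewrite lee_fin indicE; have [yA|_] := boolP (y \in A); last by rewrite mulr0.
move: yA; rewrite inE => /xA dxy; rewrite mulr1.
have xy : cos (th x) != cos (th y).
  by rewrite -subr_eq0 -normr_gt0 (lt_le_trans d0).
apply: (le_trans (fejer_off_diag _ _ _ xy)).
have [->|L0] := posnP L; first by rewrite !mul0r.
have p1 : 0 < L%:R * (cos (th x) - cos (th y)) ^+ 2.
  by rewrite mulr_gt0 ?ltr0n// exprn_even_gt0//= subr_eq0.
have p2 : 0 < L%:R * delta ^+ 2 by rewrite mulr_gt0 ?ltr0n// exprn_gt0.
rewrite ler_wpM2l// lef_pV2 ?posrE// ler_wpM2l//.
by rewrite -[leRHS]real_normK ?num_real// lerXn2r ?nnegrE// ltW.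
Qed.

(** One of the two truncated differences is [0]. *)
Definition dist_nat k j := ((k - j) + (j - k))%N.

Lemma cos_modeM k j x : cos_mode th k x * cos_mode th j x =
  2^-1 * (cos_mode th (k + j) x + cos_mode th (dist_nat k j) x).
Proof.
rewrite /cos_mode natrD mulrDl cosD.
suff -> : cos ((dist_nat k j)%:R * th x) = cos (k%:R * th x - j%:R * th x).
  by rewrite cosB; field.
have [kj|/ltnW kj] := leqP k j.
  rewrite /dist_nat (eqP kj : (k - j = 0)%N) add0n natrB// mulrBl.
  by rewrite -cosN opprB.
by rewrite /dist_nat (eqP kj : (j - k = 0)%N) addn0 natrB// mulrBl.
Qed.

Lemma cos_moment_fejer_smooth mu nu f L k : cos_moment th mu (fejer_smooth nu f L) k =
  \sum_(j < L) fejer_coef L j * cos_moment th nu f j *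
    (2^-1 * (cos_moment th mu (fun=> 1) (k + j) + cos_moment th mu (fun=> 1) (dist_nat k j))).
Proof.
have b1 m : bmfun (fun x => cos_mode th m x * 1).
  by apply: bmfunM; [exact: bmfun_cos_mode|exact: bmfun_cst].
have := integral_bmfun_sum mu L (fun j => fejer_coef L j * cos_moment th nu f j)
  (fun j x => cos_mode th k x * cos_mode th j x) 0.
rewrite addr0 => H; rewrite /cos_moment /Rintegral -/(cos_moment _ _ _ _).
transitivity (fine (\int[mu]_x (\sum_(j < L) fejer_coef L j * cos_moment th nu f j * (cos_mode th k x * cos_mode th j x) + 0)%:E)%E).
  congr fine; apply: eq_integral => x _; rewrite addr0 /fejer_smooth mulr_sumr.
  by congr EFin; apply: eq_bigr => j _; rewrite mulrCA.
rewrite H/=; last by move=> j; apply: bmfunM; exact: bmfun_cos_mode.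
apply: eq_bigr => j _; congr (_ * _).
rewrite -!/(Rintegral _ _ _) -RintegralD//; [|exact: bmfun_int..].
rewrite -RintegralZl//; last by apply: bmfun_int; exact: bmfunD.
by apply: eq_Rintegral => x _; rewrite cos_modeM !mulr1.
Qed.

Lemma cos_moment_cst1_0 mu : cos_moment th mu (fun=> 1%R) 0 = 1.
Proof.
rewrite /cos_moment /cos_mode; under eq_Rintegral do rewrite mul0r cos0 mul1r.
by rewrite Rintegral_cst// mul1r [X in fine X](probability_setT mu).
Qed.

(** The product formula for cosines expresses the moments of the reweighted
    measures by those of [mu n]; in the limit only the terms of total frequency
    [0] survive, and leave the Fejer multiplier [(L - k) / L] in front of the
    [k]-th moment of [f nu]. *)
Lemma cos_moment_fejer_smooth_cvg (mu : nat -> probability T R) nu f L k :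
  (forall m, cos_moment th (mu n) (fun=> 1) m.+1 @[n --> \oo] --> (0 : R)) ->
  cos_moment th (mu n) (fejer_smooth nu f L) k @[n --> \oo] -->
  (L - k)%:R / L%:R * cos_moment th nu f k.
Proof.
move=> mu0.
have muc m : cos_moment th (mu n) (fun=> 1) m @[n --> \oo] --> ((m == 0%N)%:R : R).
  case: m => [|m]; last exact: mu0.
  rewrite (_ : (fun _ => _) = (fun=> 1)); first exact: cvg_cst.
  by apply/funext => n; exact: cos_moment_cst1_0.
have -> : (L - k)%:R / L%:R * cos_moment th nu f k = \sum_(j < L) fejer_coef L j * cos_moment th nu f j *
    (2^-1 * ((k + j == 0)%N%:R + (dist_nat k j == 0)%N%:R)).
  have djk j : (dist_nat k j == 0)%N = (j == k).
    by rewrite addn_eq0 !subn_eq0 -eqn_leq eq_sym.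
  have [kL|Lk] := ltnP k L; last first.
    rewrite (eqP Lk : (L - k = 0)%N) !mul0r big1// => j _.
    have jk : (j < k)%N by rewrite (leq_trans (ltn_ord j)).
    have k0 : (k == 0)%N = false by rewrite gtn_eqF// (leq_ltn_trans _ jk).
    by rewrite djk addn_eq0 k0 (ltn_eqF jk) /= addr0 !mulr0.
  rewrite (bigD1 (Ordinal kL))//= big1 ?addr0; last first.
    move=> j; rewrite -val_eqE/= => jk; rewrite djk (negbTE jk) addn_eq0.
    by case: k jk {kL djk} => [|k] jk; rewrite ?(negbTE jk) ?addr0 ?mulr0.
  rewrite djk eqxx /fejer_coef addn_eq0 andbb.
  move: ((L - k)%:R / L%:R) (cos_moment _ _ _ _) => a b.
  by case: (k == 0)%N => /=; field.
under eq_fun do rewrite cos_moment_fejer_smooth.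
apply: (cvg_sum_ord L (fun j n => fejer_coef L j * cos_moment th nu f j *
    (2^-1 * (cos_moment th (mu n) (fun=> 1) (k + j) + cos_moment th (mu n) (fun=> 1) (dist_nat k j))))
  (fun j => fejer_coef L j * cos_moment th nu f j *
    (2^-1 * ((k + j == 0)%N%:R + (dist_nat k j == 0)%N%:R)))) => j.
by apply: cvgMl_tmp; apply: cvgMl_tmp; exact: cvgD.
Qed.

Lemma indic01 A (x : T) : 0 <= (\1_A x : R) <= 1.
Proof. by rewrite indicE; case: (_ \in _); rewrite /= ?lexx ?ler01. Qed.

(** The constant term of the minorant uses up [ln 4 - e] of the energy, so the
    term of frequency [m + 1] is at most [eta + e]; the weight of that frequency
    is bounded below independently of [e], which may thus tend to [0]. *)
Lemma cos_moment_cst1_bound mu (eta : R) (m : nat) : 0 <= eta ->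
  (energy th mu (fun=> 1%R) <= (ln 4 + eta)%:E)%E ->
  2^-1 ^+ m / m.+1%:R * cos_moment th mu (fun=> 1%R) m.+1 ^+ 2 <= eta.
Proof.
move=> eta0 Emu; apply/ler_addgt0Pr => e e0.
have [n [w [mn w0 w00 wm wmin]]] := logker_cos_minorant e m.+1 e0.
have := energy_ge_moments th mth w n wmin mu (fun=> 1%R) 1 (measurable_cst _).
have H (x : T) : 0 <= (1 : R) <= 1 by rewrite ler01 lexx.
move=> /(_ H)/le_trans/(_ Emu); rewrite lee_fin.
case: n mn wmin => [//|n] mn wmin.
rewrite big_ord_recl cos_moment_cst1_0 expr1n mulr1 (bigD1 (Ordinal (mn : (m < n)%N)))//=.
set S := \sum_(i < n | _) _ => HS.
have S0 : 0 <= S by apply: sumr_ge0 => i _; rewrite mulr_ge0 ?sqr_ge0.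
have : 2^-1 ^+ m / m.+1%:R * cos_moment th mu (fun=> 1%R) m.+1 ^+ 2 <=
  w m.+1 * cos_moment th mu (fun=> 1%R) m.+1 ^+ 2 by rewrite ler_wpM2r ?sqr_ge0.
move: HS w00 S0; rewrite (_ : bump 0 m = m.+1)// {}/S; clear H Emu w0 wm wmin.
move: (w m.+1 * _) (_ / _ * _) (w 0%N) (\sum_(_ < _ | _) _) => p q r S; lra.
Qed.

Lemma cos_moment_cst1_cvg (mu : nat -> probability T R) m :
  (forall n, energy th (mu n) (fun=> 1%R) <= (ln 4 + n.+1%:R^-1)%:E)%E ->
  cos_moment th (mu n) (fun=> 1%R) m.+1 @[n --> \oo] --> (0 : R).
Proof.
move=> Emu; pose c : R := (2^-1 ^+ m / m.+1%:R)^-1.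
have c0 : 0 < 2^-1 ^+ m / m.+1%:R :> R by rewrite divr_gt0 ?exprn_gt0.
suff H : cos_moment th (mu n) (fun=> 1%R) m.+1 ^+ 2 @[n --> \oo] --> (0 : R).
  apply/cvgrPdist_lt => e e0.
  move/cvgrPdist_lt : H => /(_ (e ^+ 2)); rewrite exprn_gt0// => /(_ isT).
  apply: filterS => n; rewrite !sub0r !normrN ger0_norm ?sqr_ge0// => he.
  by rewrite -ltr_sqr ?nnegrE// ?ltW// real_normK// num_real.
apply: (@squeeze_cvgr _ _ _ _ (fun=> 0) (fun n => c * n.+1%:R^-1)).
- near=> n; rewrite sqr_ge0/= /c mulrC ler_pdivlMr// mulrC.
  by apply: cos_moment_cst1_bound.
- exact: cvg_cst.
- rewrite -[X in _ --> X](mulr0 c); apply: cvgMl_tmp; exact: cvg_harmonic.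
Unshelve. all: by end_near. Qed.

(** The measures [mu n], of energy close to the minimum [ln 4], can imitate any
    [nu] of finite energy: reweighting one of them by the Fejer mean of [nu]
    restricted to [A], and cutting it down to [B], gives a probability of about
    the same energy as [nu].  The set [A] carries most of [nu], and its distance
    [delta] to the complement of [B] limits the mass lost outside [B]. *)
Lemma near_equilibrium_transfer (mu : nat -> probability T R) (nu : probability T R)
    (A B : set T) (delta E tau : R) :
  (forall n, energy th (mu n) (fun=> 1%R) <= (ln 4 + n.+1%:R^-1)%:E)%E ->
  measurable A -> measurable B -> 0 < delta ->
  (forall x y, ~ B x -> A y -> delta <= `|cos (th x) - cos (th y)|) ->
  (energy th nu (fun=> 1%R) <= E%:E)%E ->
  0 < tau -> tau < 4^-1 -> ((1 - tau)%:E <= nu A)%E ->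
  exists n (nu' : probability T R),
  [/\ (forall C, measurable C -> mu n C = 0 -> nu' C = 0)%E,
    nu' (~` B) = 0%E &
    (energy th nu' (fun=> 1%R) <= ((1 - 3 * tau) ^- 2 * (E + 2 * tau))%:E)%E].
Proof.
move=> Emu mA mB d0 AB Enu t0 t4 nuA.
have b1A : bmfun (\1_A : T -> R).
  by split; [exact: measurable_indic|exists 1 => y; rewrite ger0_norm ?indic_le1].
(* L bounds the mass lost outside B; then comes M, and only then e = tau / M ^ 2. *)
have [L L0 Ltau] : exists2 L, (0 < L)%N & 4 / (L%:R * delta ^+ 2) <= tau.
  have d20 : 0 < delta ^+ 2 by rewrite exprn_gt0.
  exists (Num.truncn (4 / (tau * delta ^+ 2))).+1 => //.
  have := truncnS_gt (4 / (tau * delta ^+ 2)).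
  rewrite ltr_pdivrMr ?mulr_gt0// => /ltW H.
  by rewrite ler_pdivrMr ?mulr_gt0// mulrCA.
pose f := fejer_smooth nu \1_A L.
have f0 x : 0 <= f x by apply: fejer_smooth_ge0.
have bf : bmfun f by exact: bmfun_fejer_smooth.
have [mf _] := bf.
pose M := 1 + \sum_(k < L) `|fejer_coef L k * cos_moment th nu \1_A k|.
have M1 : 1 <= M by rewrite lerDl sumr_ge0.
have M0 : 0 < M by rewrite (lt_le_trans _ M1).
have fM x : 0 <= f x <= M.
  by rewrite f0/= (le_trans (fejer_smooth_le _ _ _ _))// lerDr.
have M20 : 0 < M ^+ 2 by rewrite exprn_gt0.
have e0 : 0 < tau / M ^+ 2 by rewrite divr_gt0.
have [N [w [N0 w0 w00 _ wmin]]] := logker_cos_minorant (tau / M ^+ 2) 0 e0.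
pose S n := \sum_(k < N) w k * cos_moment th (mu n) f k ^+ 2.
pose Sl := \sum_(k < N) w k * ((L - k)%:R / L%:R * cos_moment th nu \1_A k) ^+ 2.
have momf k := cos_moment_fejer_smooth_cvg mu nu \1_A L k
  (fun m => cos_moment_cst1_cvg mu m Emu).
have ScvgSl : S n @[n --> \oo] --> Sl.
  apply: (cvg_sum_ord N (fun k n => w k * cos_moment th (mu n) f k ^+ 2)
    (fun k => w k * ((L - k)%:R / L%:R * cos_moment th nu \1_A k) ^+ 2)) => k.
  apply: cvgMl_tmp; rewrite expr2; under eq_fun do rewrite expr2.
  by apply: cvgM; exact: momf.
(* The weight of frequency 0 may be negative, but its Fejer multiplier is 1. *)
have SlE : Sl <= E.
  rewrite -lee_fin; apply: le_trans Enu.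
  have ind01 x : 0 <= (\1_A x : R) <= 1 * 1 by rewrite mulr1 indic01.
  have := energy_le_scaled th mth nu (fun=> 1%R) \1_A 1 (measurable_cst _)
    (measurable_indic mA) ler01 (fun=> ler01) ind01.
  rewrite expr1n mul1e; apply: le_trans.
  have := energy_ge_moments th mth w N wmin nu \1_A 1 (measurable_indic mA) (indic01 A).
  apply: le_trans; rewrite lee_fin; apply: ler_sum => -[[|k] kN] _ /=.
    by rewrite subn0 divff ?pnatr_eq0 -?lt0n// mul1r.
  rewrite ler_wpM2l// exprMn -[leRHS]mul1r ler_wpM2r ?sqr_ge0//.
  rewrite -[leRHS](expr1n _ 2) lerXn2r ?nnegrE ?divr_ge0//.
  by rewrite ler_pdivrMr ?ltr0n// mul1r ler_nat leq_subr.
have mom0 : cos_moment th (mu n) f 0 @[n --> \oo] --> fine (nu A).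
  have := momf 0%N; rewrite subn0 divff ?pnatr_eq0 -?lt0n// mul1r.
  suff -> : cos_moment th nu \1_A 0 = fine (nu A) by [].
  rewrite /cos_moment /cos_mode; under eq_Rintegral do rewrite mul0r cos0 mul1r.
  by rewrite /Rintegral integral_indic// setIT.
have nuA' : 1 - tau <= fine (nu A).
  rewrite -lee_fin fineK//; apply: fin_num_measure => //.
(* From here on a single n, beyond which the three limits are close enough. *)
have [n [n1 n2 n3]] : exists n, [/\ S n <= Sl + tau / 2,
    fine (nu A) - tau <= cos_moment th (mu n) f 0 & n.+1%:R^-1 <= tau / M ^+ 2 / 2].
  near \oo => n; exists n; split; near: n.
  - move/cvgrPdist_le : ScvgSl => /(_ (tau / 2)); rewrite divr_gt0// => /(_ isT).
    by apply: filterS => n; rewrite ler_norml => /andP[h _]; lra.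
  - move/cvgrPdist_le : mom0 => /(_ tau); rewrite t0 => /(_ isT).
    by apply: filterS => n; rewrite ler_norml => /andP[_ h]; lra.
  - have := @cvg_harmonic R; move/cvgrPdist_le => /(_ (tau / M ^+ 2 / 2)).
    rewrite divr_gt0// => /(_ isT); apply: filterS => n.
    by rewrite sub0r normrN ger0_norm ?harmonic_ge0.
have Ef : (energy th (mu n) f <= (E + 2 * tau)%:E)%E.
  have := energy_reweighted_le th mth w N wmin (mu n) f M mf M0 fM.
  rewrite -leeBrDr// => /le_trans; apply.
  apply: (@le_trans _ _ ((M ^+ 2)%:E * (ln 4 + n.+1%:R^-1)%:E + (S n)%:E -
      (M ^+ 2 * (ln 4 - tau / M ^+ 2))%:E)%E).
    apply: leeB; first by rewrite leeD2r// lee_wpmul2l// lee_fin ltW.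
    rewrite lee_fin ler_pM2l//.
    case: (N) N0 => // N' _; rewrite big_ord_recl cos_moment_cst1_0 expr1n mulr1.
    apply: (le_trans w00); rewrite lerDl sumr_ge0// => k _.
    by apply: mulr_ge0; [exact: (w0 k)|exact: sqr_ge0].
  rewrite -EFinM -EFinN -!EFinD lee_fin.
  have : M ^+ 2 * n.+1%:R^-1 <= tau / 2.
    by rewrite mulrC -ler_pdivlMr// mulrAC.
  have -> : M ^+ 2 * (ln 4 - tau / M ^+ 2) = M ^+ 2 * ln 4 - tau.
    by field; rewrite gt_eqF.
  rewrite mulrDr; move: (M ^+ 2 * ln 4) (M ^+ 2 / _) n1 SlE => p q n1 SlE; lra.
pose m' := (\int[mu n]_x (f x * \1_B x))%R.
have bfB : bmfun (fun x => f x * \1_B x).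
  apply: bmfunM => //; split; first exact: measurable_indic.
  by exists 1 => y; rewrite ger0_norm ?indic_le1.
have m'_ge : 1 - 3 * tau <= m'.
  suff : cos_moment th (mu n) f 0 <= m' + tau by lra.
  have -> : m' + tau = (\int[mu n]_x (f x * \1_B x + tau))%R.
    rewrite RintegralD//; [|exact: bmfun_int|exact: bmfun_int (bmfun_cst _)].
    by rewrite Rintegral_cst// [X in fine X](probability_setT (mu n)) mulr1.
  apply: le_Rintegral => //.
  - by apply: bmfun_int; apply: bmfunM => //; exact: bmfun_cos_mode.
  - by apply: bmfun_int; apply: bmfunD => //; exact: bmfun_cst.
  - move=> x _; rewrite /cos_mode mul0r cos0 mul1r indicE.
    have [xB|] := boolP (x \in B); first by rewrite mulr1 lerDl ltW.
    rewrite notin_setE mulr0 add0r => xB; apply: le_trans Ltau.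
    by apply: fejer_smooth_off => // y; exact: AB.
have m'0 : 0 < m' by apply: lt_le_trans m'_ge; lra.
pose g x := m'^-1 * (f x * \1_B x).
have ind01 := indic01 B.
have mi0 : 0 <= m'^-1 by rewrite invr_ge0 ltW.
have bg : bmfun g by apply: bmfunM => //; exact: bmfun_cst.
have g0 x : 0 <= g x.
  by have /andP[? _] := ind01 x; rewrite /g mulr_ge0// mulr_ge0.
have gf x : 0 <= g x <= m'^-1 * f x.
  rewrite g0/= ler_wpM2l// -[leRHS]mulr1 ler_wpM2l//.
have g1 : (\int[mu n]_x (g x)%:E = 1)%E.
  under eq_integral do rewrite EFinM.
  rewrite integralZl//; last exact: bmfun_int.
  have -> : (\int[mu n]_x (f x * \1_B x)%:E = m'%:E)%E.
    by rewrite /m' /Rintegral fineK//; apply: integrable_fin_num => //; exact: bmfun_int.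
  by rewrite -EFinM mulVf// gt_eqF.
have [mg _] := bg.
have [nu' [nu'0 nu'B Enu']] := exists_with_density th mth (mu n) g mg g0 g1.
exists n, nu'; split => //.
  apply: nu'B; first exact: measurableC.
  by move=> x xB; rewrite /g indicE memNset// !mulr0.
rewrite Enu'; apply: (le_trans (energy_le_scaled th mth (mu n) f g m'^-1 mf mg mi0 f0 gf)).
have Ef0 : (0 <= energy th (mu n) f)%E.
  apply: dint_ge0 => x y; rewrite mule_ge0 ?logker_ge0// lee_fin mulr_ge0//.
have Et0 : 0 <= E + 2 * tau by rewrite -lee_fin (le_trans Ef0).
apply: (@le_trans _ _ ((m'^-1 ^+ 2)%:E * (E + 2 * tau)%:E)%E).
  by rewrite lee_wpmul2l// lee_fin sqr_ge0.
rewrite -EFinM lee_fin ler_wpM2r// exprVn.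
have t3 : 0 < 1 - 3 * tau by lra.
by rewrite lef_pV2 ?posrE ?exprn_gt0// lerXn2r ?nnegrE// ltW.
Unshelve. all: by end_near. Qed.

End smoothing.

(** * The arcsine law *)
Section arcsine.
Context {R : realType}.

(** In angular coordinates the arcsine law is the uniform law. *)
Definition uniform_0pi : probability (measurableTypeR R) R :=
  [the probability _ R of uniform_prob (@pi_gt0 R)].

Lemma uniform_0pi_null (S : set R) (x y : R) : measurable S ->
  S `&` `[0, pi] `<=` [set x; y] -> uniform_0pi S = 0%E.
Proof.
move=> mS Sxy; rewrite -[LHS]/(\int[lebesgue_measure]_(z in S) (uniform_pdf 0 pi z)%:E)%E.
rewrite integral_uniform_pdf; apply: null_set_integral.
- exact: measurableI.
- by apply/measurable_EFinP; apply: measurable_funTS; exact: measurable_uniform_pdf.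
- apply: countable_lebesgue_measure0; apply: sub_countable (subset_card_le Sxy) _.
  by apply: finite_set_countable; rewrite finite_setU; split; exact: finite_set1.
Qed.

(** The fundamental theorem of calculus is applied to the nonnegative function
    [1 + cos ((k + 1) x)], because integrals of nonnegative functions against the
    uniform law reduce to Lebesgue integrals. *)
Lemma uniform_0pi_cos_moment k : (\int[uniform_0pi]_x cos (k.+1%:R * x))%R = 0 :> R.
Proof.
pose F (x : R) := x + k.+1%:R^-1 * sin (k.+1%:R * x).
have k0 : k.+1%:R != 0 :> R by rewrite pnatr_eq0.
have dF (x : R) : is_derive x 1 F (1 + cos (k.+1%:R * x)).
  have := is_deriveD (is_derive_id x 1) (is_deriveZ (k.+1%:R^-1 : R)
    (is_derive1_comp (is_derive_sin (k.+1%:R * x))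
      (is_deriveZ (k.+1%:R : R) (is_derive_id x 1)))).
  move/is_derive_eq; apply.
  by rewrite /GRing.scale/= mulr1 mulrCA mulVf// mulr1.
have cF : continuous F.
  move=> x; apply: differentiable_continuous.
  by apply/derivable1_diffP; have [] := dF x.
have mc : measurable_fun setT (fun x : R => cos (k.+1%:R * x)).
  apply: continuous_measurable_fun => x; apply: continuous_comp; last exact: continuous_cos.
  exact: mulrl_continuous.
have b : bmfun (fun x : measurableTypeR R => cos (k.+1%:R * x)).
  by split => //; exists 1 => x; exact: cos_max.
have H : (\int[uniform_0pi]_x (1 + cos (k.+1%:R * x))%:E = 1)%E.
  rewrite integral_uniform.
  - rewrite (@continuous_FTC2 _ _ F)//.
    + rewrite /F mulr0 sin0 mulr0 addr0 mulr_natl.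
      have -> : sin (pi *+ k.+1) = 0 :> R.
        by elim: (k.+1) => [|n IH]; rewrite ?mulr0n ?sin0// mulrSr sinDpi IH oppr0.
      by rewrite mulr0 addr0 !subr0 -EFinB subr0 -EFinM mulVf// gt_eqF// pi_gt0.
    + exact: pi_gt0.
    + apply: continuous_subspaceT => x.
      apply: cvgD; first exact: cvg_cst.
      by apply: continuous_comp; [exact: mulrl_continuous|exact: continuous_cos].
    + split => [x _| |]; first by have [] := dF x.
        exact/cvg_at_right_filter/cF.
      exact/cvg_at_left_filter/cF.
    + by move=> x _; rewrite derive1E; have [_ ->] := dF x.
  - by apply/measurable_EFinP; apply: measurable_funD.
  - by move=> x; rewrite lee_fin -lerBlDl sub0r cos_geN1.
have := integral_bmfun_sum uniform_0pi 1 (fun=> 1) (fun _ x => cos (k.+1%:R * x)) 1 (fun=> b).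
under eq_integral do rewrite big_ord1 mul1r addrC.
by rewrite H big_ord1 mul1r => -[] /esym/eqP; rewrite -subr_eq0 addrK => /eqP.
Qed.

Lemma measurable_cos_angle : measurable_fun setT (fun x : measurableTypeR R => cos x : R).
Proof. by apply: continuous_measurable_fun => x; exact: continuous_cos. Qed.

Lemma poisson_log_cvg (a b : R) : cos a != cos b ->
  poisson_log (1 - n.+2%:R^-1) a b @[n --> \oo] --> - ln (2 * `|cos a - cos b|).
Proof.
move=> ab.
pose D t s : R := 1 - 2 * s * cos t + s ^+ 2.
have D1 t : D t 1 = 2 * (1 - cos t) by rewrite /D; ring.
have p0 : 0 < (cos a - cos b) ^+ 2 by rewrite exprn_even_gt0//= subr_eq0.
have [t1 t2] : 0 < 1 - cos (a - b) /\ 0 < 1 - cos (a + b).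
  move: p0; rewrite -cos_dist_factor => h.
  have h1 : 0 <= 1 - cos (a - b) by rewrite subr_ge0 cos_le1.
  have h2 : 0 <= 1 - cos (a + b) by rewrite subr_ge0 cos_le1.
  by split; rewrite lt_neqAle ?h1 ?h2 andbT eq_sym; apply: contraTneq h => ->;
    rewrite ?mul0r ?mulr0 ltxx.
have cD t : D t (1 - n.+2%:R^-1) @[n --> \oo] --> D t 1.
  have s1 : (1 - n.+2%:R^-1 : R) @[n --> \oo] --> (1 : R).
    rewrite -[X in _ --> X]subr0; apply: cvgB; first exact: cvg_cst.
    have := @cvg_harmonic R; rewrite -(cvg_shiftS (fun n => n.+1%:R^-1 : R)).
    exact.
  apply: cvgD; last by apply: cvgM.
  apply: cvgB; first exact: cvg_cst.
  by apply: cvgMr_tmp; apply: cvgMl_tmp.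
have cl t : 0 < 1 - cos t -> 2^-1 * ln (D t (1 - n.+2%:R^-1)) @[n --> \oo] -->
    2^-1 * ln (2 * (1 - cos t)).
  move=> t0; apply: cvgMl_tmp; rewrite -D1.
  apply: continuous_cvg; last exact: cD.
  by apply: continuous_ln; rewrite D1 mulr_gt0.
have -> : - ln (2 * `|cos a - cos b|) = - (2^-1 * ln (2 * (1 - cos (a - b))) +
    2^-1 * ln (2 * (1 - cos (a + b)))).
  congr (- _); rewrite -mulrDr -lnM ?posrE ?mulr_gt0//.
  rewrite mulrACA cos_dist_factor -[X in _ = _ * ln (_ * X)]real_normK ?num_real//.
  rewrite -[2 * 2]expr2 -exprMn lnXn; last by rewrite mulr_gt0// normr_gt0 subr_eq0.
  by rewrite -mulr_natr; move: (ln _) => l; field.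
by apply: cvgN; apply: cvgD; exact: cl.
Qed.

Lemma measurable_poisson_log s b : 0 <= s < 1 ->
  measurable_fun setT (fun a : R => poisson_log s a b).
Proof.
move=> s01; have mD (t : R) : measurable_fun setT (fun a : R => 1 - 2 * s * cos (a + t) + s ^+ 2).
  apply: continuous_measurable_fun => x.
  apply: cvgD; last exact: cvg_cst.
  apply: cvgB; first exact: cvg_cst.
  apply: cvgMl_tmp; apply: continuous_comp; last exact: continuous_cos.
  by apply: cvgD; [exact: cvg_id|exact: cvg_cst].
rewrite /poisson_log; apply: measurableT_comp => //.
by apply: measurable_funD; apply: measurable_funM => //;
  apply: measurableT_comp => //; exact: mD.
Qed.

(** The regularized kernel is, up to an arbitrarily small error, a cosine
    polynomial without constant term. *)
Lemma integral_poisson_log_le s b : 0 <= s < 1 ->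
  (\int[uniform_0pi]_a (ln 4 + poisson_log s a b)%:E <= (ln 4)%:E)%E.
Proof.
move=> s01; apply/lee_addgt0Pr => e e0.
have /andP[s0 s1] := s01.
have [n en] : exists n, 4 * s ^+ n / (1 - s) ^+ 2 <= e.
  have : 4 * s ^+ n / (1 - s) ^+ 2 @[n --> \oo] --> 4 * 0 / (1 - s) ^+ 2.
    by apply: cvgMr_tmp; apply: cvgMl_tmp; apply: cvg_expr; rewrite ger0_norm.
  rewrite mulr0 mul0r => /cvgrPdist_le/(_ e e0)[n _ /(_ n (leqnn _))].
  by rewrite sub0r normrN => /(le_trans (ler_norm _)) H; exists n.
pose p k (x : measurableTypeR R) := cos (k.+1%:R * x).
have bp k : bmfun (p k).
  split; last by exists 1 => x; exact: cos_max.
  apply: continuous_measurable_fun => x; apply: continuous_comp; last exact: continuous_cos.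
  exact: mulrl_continuous.
have := integral_bmfun_sum uniform_0pi n
  (fun k => 2 * (s ^+ k.+1 / k.+1%:R) * cos (k.+1%:R * b)) p (ln 4 + e) bp.
rewrite big1 ?add0r; last by move=> k _; rewrite uniform_0pi_cos_moment mulr0.
rewrite EFinD => <-; apply: ge0_le_integral => //.
- move=> x _; rewrite lee_fin -lerBlDl sub0r; exact: poisson_log_ge.
- apply/measurable_EFinP; apply: measurable_funD => //; exact: measurable_poisson_log.
- apply/measurable_EFinP; apply: measurable_funD => //.
  have [] // := bmfun_sum n (fun k x => 2 * (s ^+ k.+1 / k.+1%:R) * cos (k.+1%:R * b) * p k x).
  by move=> k; apply: bmfunM => //; exact: bmfun_cst.
- move=> x _; rewrite lee_fin.
  have := cheb_sum_poisson s n x b s01; rewrite ler_norml => /andP[h _].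
  suff -> : \sum_(k < n) 2 * (s ^+ k.+1 / k.+1%:R) * cos (k.+1%:R * b) * p k x = cheb_sum s n x b by lra.
  by apply: eq_bigr => k _; rewrite /p -mulrA [cos _ * _]mulrC.
Qed.

(** Fatou along [s -> 1].  The regularized kernels converge to the kernel off the
    diagonal, which is negligible, and they are nonnegative once [ln 4] is
    added. *)
Lemma arcsine_potential b : 
  (\int[uniform_0pi]_a logker a b <= (ln 4)%:E)%E.
Proof.
pose D := [set a : measurableTypeR R | cos a != cos b].
have mc : measurable_fun setT (fun x : measurableTypeR R => cos x) by exact: measurable_cos_angle.
have mD : measurable D.
  rewrite /D (_ : [set _ | _] = (fun x => cos x) @^-1` [set~ cos b]).
    by rewrite -[X in measurable X]setTI; apply: mc => //; apply: measurableC; exact: measurable_set1.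
  by apply/seteqP; split => x /= /eqP.
have D0 : uniform_0pi (~` D) = 0%E.
  apply: (@uniform_0pi_null _ (acos (cos b)) 0); first exact: measurableC.
  move=> x [/negP/negPn/eqP xb] /=; rewrite in_itv/= => x0; left.
  by rewrite -xb cosK// in_itv.
have mk : measurable_fun setT (fun a => logker a b).
  exact: (measurable2_l _ b (measurable2_logker _ measurable_cos_angle)).
rewrite (ge0_negligible_integral (measurableC mD))//; last by move=> x _; exact: logker_ge0.
rewrite setTD setCK.
pose s n : R := 1 - n.+2%:R^-1.
have s01 n : 0 <= s n < 1.
  rewrite /s subr_ge0 ltrBlDr ltrDl invr_gt0 ltr0n andbT.
  by rewrite invf_le1// ler1n.
pose F n (a : measurableTypeR R) := (ln 4 + poisson_log (s n) a b)%:E.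
have F0 n x : (0 <= F n x)%E.
  by rewrite lee_fin -lerBlDl sub0r; exact: poisson_log_ge.
have mF n : measurable_fun setT (F n).
  by apply/measurable_EFinP; apply: measurable_funD => //; exact: measurable_poisson_log.
have FE a : D a -> limn_einf (F^~ a) = logker a b.
  move=> ab; have cF : F n a @[n --> \oo] --> logker a b.
    rewrite (logkerE _ _ ab); apply: cvg_EFin; first by near=> n.
    by apply: cvgD; [exact: cvg_cst|exact: poisson_log_cvg].
  by rewrite is_cvg_limn_einfE; [exact: cvg_lim|apply/cvg_ex; eexists; exact: cF].
rewrite (eq_integral (fun a : measurableTypeR R => limn_einf (F^~ a))); last first.
  by move=> a /set_mem /FE.
have mF' n : measurable_fun D (F n) by apply: measurable_funTS; exact: mF.
apply: (le_trans (fatou uniform_0pi mD mF' (fun n x _ => F0 n x))).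
rewrite limn_einf_lim; apply: lime_le; first exact: is_cvg_einfs.
near=> n; apply: (@le_trans _ _ (\int[uniform_0pi]_(x in D) F n x)%E).
  by apply: ereal_inf_lbound; exists n => /=.
apply: le_trans (integral_poisson_log_le (s n) b (s01 n)).
by apply: ge0_subset_integral => // x _; exact: F0.
Unshelve. all: by end_near. Qed.

Lemma arcsine_energy :
  (energy (fun x : measurableTypeR R => x) uniform_0pi (fun=> 1%R) <= (ln 4)%:E)%E.
Proof.
rewrite -[leRHS](integral_probability_cst uniform_0pi); apply: ge0_le_integral => //.
- by move=> y _; apply: integral_ge0 => x _; rewrite mule_ge0 ?logker_ge0// lee_fin mulr1.
- apply: measurable2_int.
    exact: (measurable2_logkerM _ measurable_cos_angle (fun=> 1%R) (measurable_cst _)).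
  by move=> x y; rewrite mule_ge0 ?logker_ge0// lee_fin mulr1.
- move=> y _; apply: le_trans (arcsine_potential y).
  by under eq_integral do rewrite mulr1 mule1.
Qed.

End arcsine.

Section atoms.
Context {d} {T : measurableType d} {R : realType}.
Variable th : T -> R.
Hypothesis mth : measurable_fun setT (fun x => cos (th x)).

(** The kernel is infinite on the diagonal, so it dominates every multiple of the
    indicator of [(p, p)]. *)
Lemma energy_atom (nu : probability T R) (p : T) : measurable [set p] ->
  (energy th nu (fun=> 1%R) < +oo)%E -> nu [set p] = 0%E.
Proof.
move=> mp Enu.
have m1 : measurable_fun setT (\1_[set p] : T -> R) by exact: measurable_indic.
have ind1 := @indic01 _ T R [set p].
have b1 : bmfun (\1_[set p] : T -> R).
  by split => //; exists 1 => x; have /andP[? ?] := ind1 x; rewrite ger0_norm.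
have Ep : (energy th nu \1_[set p] <= energy th nu (fun=> 1%R))%E.
  have := energy_le_scaled th mth nu (fun=> 1%R) \1_[set p] 1 (measurable_cst _) m1 ler01 (fun=> ler01).
  rewrite expr1n mul1e; apply => x; by rewrite mulr1.
have mass : (\int[nu]_x \1_[set p] x)%R = fine (nu [set p]).
  by rewrite /Rintegral integral_indic// setIT.
have low (k : R) : 0 <= k -> ((k * fine (nu [set p]) ^+ 2)%:E <= energy th nu \1_[set p])%E.
  move=> k0.
  have := dint_bmfun_sum nu 1 (fun=> k) (fun=> \1_[set p] : T -> R) 0 (fun=> b1).
  rewrite big_ord1 mass addr0 => <-; apply: dint_le.
  - have := measurable2_cos_kernel th mth (fun=> k) 1 \1_[set p] 0 m1.
    by congr measurable2; apply/funext => x; apply/funext => y;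
      rewrite /cos_kernel !big_ord1 !mul0r cos0 !mulr1.
  - exact: measurable2_logkerM.
  - move=> x y; rewrite big_ord1 addr0 lee_fin mulr_ge0// mulr_ge0//;
    by [have /andP[] := ind1 x|have /andP[] := ind1 y].
  - move=> x y; rewrite big_ord1 addr0 !indicE.
    have [|_] := boolP (x \in [set p]); last by rewrite mul0r mulr0 mule0.
    rewrite inE/= => ->; have [|_] := boolP (y \in [set p]); last by rewrite !mulr0 mule0.
    rewrite inE/= => ->; rewrite logker_diag// !mulr1 mule1 leey//.
have nup0 : 0 <= fine (nu [set p]) by rewrite fine_ge0.
have fnu : nu [set p] \is a fin_num by apply: fin_num_measure.
rewrite -(fineK fnu); congr EFin; apply/eqP; rewrite eq_le nup0 andbT leNgt.
apply/negP => pos.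
have [E EE] : exists E : R, (energy th nu \1_[set p] <= E%:E)%E.
  exists (fine (energy th nu (fun=> 1%R))); rewrite fineK// ge0_fin_numE//.
  by apply: dint_ge0 => x y; rewrite mule_ge0 ?logker_ge0// lee_fin mulr1.
have E0 : 0 <= E.
  rewrite -lee_fin; apply: le_trans EE; apply: dint_ge0 => x y.
  have /andP[? _] := ind1 x; have /andP[? _] := ind1 y.
  by rewrite mule_ge0 ?logker_ge0// lee_fin mulr_ge0.
have s0 : 0 < fine (nu [set p]) ^+ 2 by rewrite exprn_gt0.
have k0 : 0 <= (E + 1) / fine (nu [set p]) ^+ 2.
  by apply: divr_ge0; [lra|exact: ltW].
have := le_trans (low _ k0) EE; rewrite divfK ?gt_eqF// lee_fin; lra.
Qed.

End atoms.

(** * Borel sets of the plane *)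
Section complex_borel.
Context {R : realType}.

Lemma measurable_Re : measurable_fun setT (fun z : borelC R => complex.Re z).
Proof.
apply: (measurability _ (RGenOInfty.measurableE R)) => _ [_ [x ->] <-].
rewrite setTI; apply: sub_sigma_algebra.
rewrite openE => /= z; rewrite /= in_itv/= andbT => xz.
apply/nbhs_ballP; exists (complex.Re z - x)%:C => /=; first by rewrite ltcR subr_gt0.
move=> w; rewrite /ball/= => zw; rewrite in_itv/= andbT.
have := le_lt_trans (normc_ge_Re _) zw; rewrite ltcR raddfB/=.
by move/(le_lt_trans (ler_norm _)); rewrite ltrD2l ltrN2.
Qed.

Lemma measurable_Im : measurable_fun setT (fun z : borelC R => complex.Im z).
Proof.
apply: (measurability _ (RGenOInfty.measurableE R)) => _ [_ [x ->] <-].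
rewrite setTI; apply: sub_sigma_algebra.
rewrite openE => /= z; rewrite /= in_itv/= andbT => xz.
apply/nbhs_ballP; exists (complex.Im z - x)%:C => /=; first by rewrite ltcR subr_gt0.
move=> w; rewrite /ball/= => zw; rewrite in_itv/= andbT.
have ImRe (u : R[i]) : complex.Im u = complex.Re (- u * 'i)%C by case: u => a b /=; ring.
have Hle : (`|complex.Im (z - w)|%:C <= `|z - w|)%R.
  rewrite ImRe; apply: (le_trans (normc_ge_Re _)).
  by rewrite normrM normrN [`|'i%C|]normc_def/= expr0n/= expr1n add0r sqrtr1 mulr1.
have := le_lt_trans Hle zw; rewrite ltcR raddfB/=.
by move/(le_lt_trans (ler_norm _)); rewrite ltrD2l ltrN2.
Qed.

Lemma measurable_real_complex : measurable_fun setT (fun x : measurableTypeR R => x%:C : borelC R).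
Proof.
have H := @measurability _ _ (measurableTypeR R) (borelC R) setT (fun x => x%:C) (@open (R[i])^o) erefl.
apply: H => _ [U oU <-].
rewrite setTI; apply: open_measurable.
rewrite openE => /= x Ux.
have := oU; rewrite openE => /(_ _ Ux)/nbhs_ballP[e /= e0 eU].
have ee : (complex.Re e)%:C = e by rewrite RRe_real// gtr0_real.
apply/nbhs_ballP; exists (complex.Re e) => /=; first by rewrite -ltcR ee.
move=> y xy; apply: eU; rewrite /ball/= -ee -raddfB/=.
by rewrite normc_def/= expr0n/= addr0 sqrtr_sqr ltcR.
Qed.

Lemma image_real_complexE (X : set R) :
  [set x%:C | x in X] = (fun z : borelC R => complex.Re z) @^-1` X `&`
     (fun z : borelC R => complex.Im z) @^-1` [set 0].
Proof.
apply/seteqP; split => [_ [x Xx <-]//|[a b] /= [Xa ->]].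
by exists a.
Qed.

Lemma measurable_image_real (X : set R) : measurable X ->
  measurable ([set x%:C | x in X] : set (borelC R)).
Proof.
move=> mX; rewrite image_real_complexE; apply: measurableI.
  by rewrite -[X in measurable X]setTI; exact: measurable_Re.
by rewrite -[X in measurable X]setTI; exact: measurable_Im.
Qed.

Lemma normc_real (x y : R) : Normc.normc (x%:C - y%:C) = `|x - y|.
Proof. by rewrite /= subrr expr0n/= addr0 sqrtr_sqr. Qed.

Lemma measurable2_logdist :
  measurable2 (fun z w : borelC R => - lne (Normc.normc ((z : R[i]) - (w : R[i])))%:E)%E.
Proof.
apply: measurableT_comp => //.
apply: (measurableT_comp measurable_lne_EFin).
rewrite (_ : (fun _ => _) = (fun zw : borelC R * borelC R =>
  Num.sqrt ((complex.Re zw.1 - complex.Re zw.2) ^+ 2 + (complex.Im zw.1 - complex.Im zw.2) ^+ 2))).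
  have mR1 : measurable_fun setT (fun zw : borelC R * borelC R => complex.Re zw.1).
    exact: (measurableT_comp measurable_Re).
  have mR2 : measurable_fun setT (fun zw : borelC R * borelC R => complex.Re zw.2).
    exact: (measurableT_comp measurable_Re).
  have mI1 : measurable_fun setT (fun zw : borelC R * borelC R => complex.Im zw.1).
    exact: (measurableT_comp measurable_Im).
  have mI2 : measurable_fun setT (fun zw : borelC R * borelC R => complex.Im zw.2).
    exact: (measurableT_comp measurable_Im).
  have msqrt : measurable_fun setT (fun x : R => Num.sqrt x).
    by apply: continuous_measurable_fun; exact: sqrt_continuous.
  apply: (measurableT_comp msqrt).
  by apply: measurable_funD; apply: measurable_funX; apply: measurable_funB.
by apply/funext => -[[a b] [c d]].
Qed.

End complex_borel.

(** Valid also when [f] has an infinite integral: the negative part of [f - C]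
    is at most [C], hence integrable. *)
Lemma integral_ge0B_cst {d} {T : measurableType d} {R : realType}
    (mu : probability T R) (f : T -> \bar R) (C : R) :
  measurable_fun setT f -> (forall x, 0 <= f x)%E ->
  (\int[mu]_x (f x - C%:E) = \int[mu]_x f x - C%:E)%E.
Proof.
move=> mf f0.
have cstE := integral_probability_cst mu.
have [C0|C0] := leP C 0.
  have C0' : (0 <= (- C)%:E)%E by rewrite lee_fin oppr_ge0.
  by rewrite -EFinN ge0_integralD// cstE.
pose g x := (f x - C%:E)%E.
have mg : measurable_fun setT g by exact: emeasurable_funB.
have C0' : (0 <= C%:E)%E by rewrite lee_fin ltW.
have gnC x : (g^\- x <= C%:E)%E.
  rewrite funenegE ge_max C0' andbT /g.
  have := f0 x; case: (f x) => [r| |]//=; rewrite ?lee_fin; [lra|move=> _; exact: leNye].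
have N0 : (0 <= \int[mu]_x g^\- x)%E by apply: integral_ge0 => x _; exact: funeneg_ge0.
have Nfin : (\int[mu]_x g^\- x)%E \is a fin_num.
  rewrite ge0_fin_numE//; apply: (@le_lt_trans _ _ C%:E); last exact: ltry.
  rewrite -(cstE C); apply: ge0_le_integral => //; exact: measurable_funeneg.
have key : (\int[mu]_x g^\+ x + C%:E = \int[mu]_x f x + \int[mu]_x g^\- x)%E.
  rewrite -[X in (_ + X = _)%E]cstE -!ge0_integralD//; first last.
  - exact: measurable_funepos.
  - exact: measurable_funeneg.
  apply: eq_integral => x _; rewrite funeposE funenegE /g.
  have := f0 x; case: (f x) => [r| |]//= r0.
    rewrite -EFinD -!EFin_max -!EFinD; congr EFin.
    by rewrite !maxEle; case: (leP (r + - C) 0); case: (leP (- (r - C)) 0) => h1 h2; lra.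
  by rewrite addye// maxEle leNye addye.
rewrite integralE; move: key Nfin.
move: (integral mu _ g^\+%E) (integral mu _ g^\-%E) (integral mu _ f) => P N F.
case: N => [n| |]//; case: P => [p| |]//; case: F => [r| |]//=.
by rewrite -!EFinD => -[pr] _; congr EFin; lra.
Qed.

(** * From the real line to angles *)
Section chart.
Context {R : realType} (c h : R).
Hypothesis h0 : 0 < h.

(** The angle [t] such that [Re z = c + h cos t].  Values beyond the endpoints are
    clamped, to make the definition total and measurable; only real points at
    distance at most [h] from [c] matter. *)
Definition chart (z : borelC R) : R :=
  acos (Num.max (-1) (Num.min 1 ((complex.Re z - c) / h))).

Lemma cos_chartE z : cos (chart z) = Num.max (-1) (Num.min 1 ((complex.Re z - c) / h)).
Proof.
rewrite /chart acosK// in_itv/= le_max lexx/= ge_max ge_min lexx/= andbT.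
by rewrite -subr_ge0 opprK addr_ge0.
Qed.

Lemma cos_chart x : `|x - c| <= h -> cos (chart x%:C) = (x - c) / h.
Proof.
rewrite ler_norml => /andP[x1 x2]; rewrite cos_chartE /= min_r ?max_r//.
  by rewrite ler_pdivlMr// mulN1r.
by rewrite ler_pdivrMr// mul1r.
Qed.

Lemma measurable_cos_chart : measurable_fun setT (fun z => cos (chart z)).
Proof.
under eq_fun do rewrite cos_chartE.
apply: measurable_maxr => //; apply: measurable_minr => //.
apply: measurable_funM => //; apply: measurable_funB => //; exact: measurable_Re.
Qed.

Lemma logdist_chart x y : `|x - c| <= h -> `|y - c| <= h ->
  (- lne (Normc.normc (x%:C - y%:C))%:E =
   logker (chart x%:C) (chart y%:C) - (ln (2 * h))%:E)%E.
Proof.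
move=> xc yc; rewrite normc_real; have [->|xy] := eqVneq x y.
  by rewrite subrr normr0 /= lexx logker_diag.
have xy0 : 0 < `|x - y| by rewrite normr_gt0 subr_eq0.
have E : cos (chart x%:C) - cos (chart y%:C) = (x - y) / h.
  by rewrite !cos_chart// -mulrBl; congr (_ / _); ring.
have ne : cos (chart x%:C) != cos (chart y%:C).
  by rewrite -subr_eq0 E mulf_eq0 invr_eq0 (gt_eqF h0) orbF subr_eq0.
rewrite logkerE// E normrM normfV (gtr0_norm h0) lne_EFin// -EFinN -EFinB.
congr EFin; rewrite mulrA ln_div ?posrE ?mulr_gt0// !lnM ?posrE//.
have -> : 4 = 2 * 2 :> R by rewrite -natrM.
by rewrite lnM ?posrE//; ring.
Qed.

(** On [J] the two kernels differ by the constant [ln (2 h)].  Outside [J], which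
    [mu] does not charge, they are unrelated, so both the inner and the outer
    integrals are compared almost everywhere. *)
Lemma log_energyE (mu : probability (borelC R) R) (J : set R) :
  measurable J -> (forall x, J x -> `|x - c| <= h) ->
  mu (~` [set x%:C | x in J]) = 0%E ->
  log_energy mu = (energy chart mu (fun=> 1%R) - (ln (2 * h))%:E)%E.
Proof.
move=> mJ Jc muJ; set JC := [set _ | _ in _] in muJ.
have mJC : measurable (~` JC : set (borelC R)) by apply: measurableC; exact: measurable_image_real.
pose k z w := (logker (chart z) (chart w) * (1 * 1)%:E)%E.
have mk : measurable2 k.
  exact: (measurable2_logkerM chart measurable_cos_chart (fun=> 1%R) (measurable_cst _)).
have k0 z w : (0 <= k z w)%E by rewrite mule_ge0 ?logker_ge0// lee_fin mulr1.
pose K (z w : borelC R) := (- lne (Normc.normc ((z : R[i]) - (w : R[i])))%:E)%E.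
have mK : measurable2 K by exact: measurable2_logdist.
have mI : measurable_fun setT (fun w => \int[mu]_z K z w)%E by exact: measurable2_integral.
have KE (z w : borelC R) : JC z -> JC w -> K z w = (k z w - (ln (2 * h))%:E)%E.
  by move=> [x Jx <-] [y Jy <-]; rewrite /K /k mulr1 mule1 logdist_chart//; exact: Jc.
have inner (w : borelC R) : JC w -> (\int[mu]_z K z w = \int[mu]_z k z w - (ln (2 * h))%:E)%E.
  move=> Jw; rewrite -integral_ge0B_cst//; last exact: measurable2_l.
  apply: ae_eq_integral => //.
  - exact: measurable2_l.
  - by apply: emeasurable_funB => //; exact: (measurable2_l _ w mk).
  - exists (~` JC); split => // z /= H; apply: contra_not H => Jz _.
    exact: KE.
rewrite /energy /dint -integral_ge0B_cst//; first last.
- by move=> w; apply: integral_ge0 => z _; exact: k0.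
- exact: measurable2_int.
rewrite /log_energy; apply: ae_eq_integral => //.
- by apply: emeasurable_funB => //; exact: measurable2_int.
- exists (~` JC); split => // w /= H; apply: contra_not H => Jw _.
  exact: inner.
Qed.

End chart.

Section arcsine_plane.
Context {R : realType}.

Lemma logker_cos_ext (a b a' b' : R) : cos a = cos a' -> cos b = cos b' ->
  logker a b = logker a' b'.
Proof. by rewrite /logker => -> ->. Qed.

(** The arcsine law does not charge the endpoints [c - h] and [c + h], hence it
    lives on any of the intervals with these endpoints. *)
Lemma exists_arcsine_law (c h : R) : 0 < h ->
  exists rho : probability (borelC R) R,
    (energy (chart c h) rho (fun=> 1%R) <= (ln 4)%:E)%E /\
    (forall J, measurable J -> (forall x, `|x - c| < h -> J x) ->
       rho (~` [set x%:C | x in J]) = 0%E).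
Proof.
move=> h0; pose phi (t : measurableTypeR R) : borelC R := (c + h * cos t)%:C.
have mphi : measurable_fun setT phi.
  apply: (measurableT_comp measurable_real_complex).
  apply: measurable_funD => //; apply: measurable_funM => //.
  exact: measurable_cos_angle.
pose Phi : {mfun _ >-> _} := HB.pack phi (isMeasurableFun.Build _ _ _ _ _ mphi).
pose rho : probability (borelC R) R := [the probability _ _ of distribution uniform_0pi Phi].
exists rho; split.
  have mk : measurable2 (fun z w => logker (chart c h z) (chart c h w) * (1 * 1)%:E)%E.
    exact: (measurable2_logkerM _ (measurable_cos_chart c h) (fun=> 1%R) (measurable_cst _)).
  have k0 z w : (0 <= logker (chart c h z) (chart c h w) * (1 * 1)%:E)%E.
    by rewrite mule_ge0 ?logker_ge0// lee_fin mulr1.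
  suff -> : energy (chart c h) rho (fun=> 1%R) =
    energy (fun x : measurableTypeR R => x) uniform_0pi (fun=> 1%R) by exact: arcsine_energy.
  have cphi t : cos (chart c h (phi t)) = cos t.
    rewrite cos_chart//; first by rewrite addrC addKr mulrC mulKf// gt_eqF.
    by rewrite addrC addKr normrM gtr0_norm// -[leRHS]mulr1 ler_pM2l// cos_max.
  rewrite /energy /dint.
  transitivity (\int[uniform_0pi]_b \int[rho]_z (logker (chart c h z) (chart c h (phi b)) * (1 * 1)%:E))%E.
    apply: (@ge0_integral_pushforward _ _ _ _ R phi mphi uniform_0pi setT
      (fun w => \int[rho]_z (logker (chart c h z) (chart c h w) * (1 * 1)%:E))%E) => //.
      exact: measurable2_int.
    by move=> w _; apply: integral_ge0.
  apply: eq_integral => b _.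
  have := @ge0_integral_pushforward _ _ _ _ R phi mphi uniform_0pi setT
      (fun z => logker (chart c h z) (chart c h (phi b)) * (1 * 1)%:E)%E measurableT
      (measurable2_l _ (phi b) mk) (fun z _ => k0 z (phi b)).
  move=> ->; apply: eq_integral => a _ /=.
  by rewrite (logker_cos_ext _ _ a b (cphi a) (cphi b)).
move=> J mJ Jc.
apply: (uniform_0pi_null _ 0 pi).
  rewrite -[X in measurable X]setTI; apply: (mphi measurableT).
  by apply: measurableC; exact: measurable_image_real.
move=> t [] /= phit; rewrite in_itv/= => /andP[t0 tpi].
have [->|tn0] := eqVneq t 0; first by left.
have [->|tnpi] := eqVneq t pi; first by right.
exfalso; apply: phit; exists (c + h * cos t) => //; apply: Jc.
rewrite addrC addKr normrM gtr0_norm// -[ltRHS]mulr1 ltr_pM2l//.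
have t0' : 0 < t by rewrite lt_neqAle eq_sym tn0.
have tpi' : t < pi by rewrite lt_neqAle tnpi.
rewrite ltr_norml -cospi -cos0 !ltr_cos ?in_itv/= ?t0 ?tpi ?lexx ?pi_ge0//.
by rewrite tpi' t0'.
Qed.

End arcsine_plane.

(** * Intervals *)
Section real_intervals.
Context {R : realType}.
Implicit Types J : set R.

Lemma bounded_interval_ends J : is_interval J -> bounded_set J -> J !=set0 ->
  exists a b, (forall x, J x -> a <= x <= b) /\ (forall x, a < x < b -> J x).
Proof.
move=> iJ [M [_ HM]] J0; exists (inf J), (sup J).
have bJ x : J x -> `|x| <= M + 1 by apply: HM; rewrite ltrDl.
have hs : has_sup J.
  split=> //; exists (M + 1) => x /bJ; exact: le_trans (ler_norm _).
have hi : has_inf J.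
  by split=> //; exists (- (M + 1)) => x /bJ; rewrite ler_norml => /andP[].
split=> [x Jx|x /andP[ax xb]].
  by apply/andP; split; [exact: (ge_inf hi.2)|exact: sup_upper_bound].
have [y Jy yx] : exists2 y, J y & y < x.
  have d : 0 < x - inf J by rewrite subr_gt0.
  by have [y Jy] := inf_adherent d hi; rewrite addrC subrK => yx; exists y.
have [z Jz xz] : exists2 z, J z & x < z.
  have d : 0 < sup J - x by rewrite subr_gt0.
  by have [z Jz] := sup_adherent d hs; rewrite opprB addrC subrK => xz; exists z.
by apply: (iJ y z) => //; rewrite !ltW.
Qed.

Lemma dist_inner_interval (a b d x y : R) : 0 < d ->
  ~~ (a < x < b) -> a + d <= y -> y <= b - d -> d <= `|x - y|.
Proof.
move=> d0 /nandP[]; rewrite -leNgt => H y1 y2.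
  by rewrite distrC; apply: le_trans (ler_norm _); lra.
by apply: le_trans (ler_norm _); lra.
Qed.

(** Continuity from below of [nu] along an exhaustion of the open interval, whose
    endpoints are not atoms. *)
Lemma inner_interval_mass (nu : probability (borelC R) R) J (a b tau : R) :
  measurable J -> (forall x, J x -> a <= x <= b) ->
  nu (~` [set x%:C | x in J]) = 0%E ->
  nu [set a%:C] = 0%E -> nu [set b%:C] = 0%E -> 0 < tau ->
  exists2 e, 0 < e & ((1 - tau)%:E <= nu [set x%:C | x in `[(a + e)%R, (b - e)%R]])%E.
Proof.
move=> mJ Jab nuJ nua nub t0.
pose A n : set (borelC R) := [set x%:C | x in `[a + n.+1%:R^-1, b - n.+1%:R^-1]].
have mA n : measurable (A n) by exact: measurable_image_real.
have m1 (x : R) : measurable ([set x%:C] : set (borelC R)).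
  have := measurable_image_real [set x] (measurable_set1 x).
  by rewrite image_set1.
have ndA : nondecreasing_seq A.
  move=> m n mn; apply/subsetPset; apply: image_subset => x /=.
  have H : n.+1%:R^-1 <= m.+1%:R^-1 :> R by rewrite lef_pV2 ?posrE// ler_nat ltnS.
  move: (n.+1%:R^-1) (m.+1%:R^-1) H => p q H.
  by rewrite !in_itv/= => /andP[h1 h2]; apply/andP; split; lra.
have mU : measurable (\bigcup_n A n) by exact: bigcup_measurable.
have nuU : nu (\bigcup_n A n) = 1%E.
  have sub : ~` (\bigcup_n A n) `<=` (~` [set x%:C | x in J]) `|` ([set a%:C] `|` [set b%:C]).
    move=> z zU; have [[x Jx xz]|] := pselect ([set x%:C | x in J] z); last by left.
    right; have /andP[ax xb] := Jab x Jx.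
    have [xa|xa] := eqVneq x a; first by left; rewrite /= -xz xa.
    have [xb'|xb'] := eqVneq x b; first by right; rewrite /= -xz xb'.
    exfalso; apply: zU.
    have d0 : 0 < Num.min (x - a) (b - x).
      by rewrite lt_min !subr_gt0 !lt_neqAle ax xb eq_sym xa xb'.
    exists (Num.truncn (Num.min (x - a) (b - x))^-1) => //; exists x => //=.
    have := truncnS_gt (Num.min (x - a) (b - x))^-1.
    rewrite -ltf_pV2 ?posrE ?invr_gt0// invrK.
    move: (_.+1%:R^-1) => q; rewrite lt_min => /andP[h1 h2].
    by rewrite in_itv/=; apply/andP; split; lra.
  have nu0 : nu (~` (\bigcup_n A n)) = 0%E.
    have mJC : measurable (~` [set x%:C | x in J] : set (borelC R)).
      by apply: measurableC; exact: measurable_image_real.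
    apply: (subset_measure0 _ _ sub) => //.
    - exact: measurableC.
    - by apply: measurableU => //; apply: measurableU.
    - by apply: null_set_setU => //; [exact: measurableU|apply: null_set_setU].
  have := probability_setC nu (measurableC mU); rewrite setCK nu0 sube0.
  exact.
have cvgA : nu (A n) @[n --> \oo] --> nu (\bigcup_n A n).
  exact: nondecreasing_cvg_mu.
have [n nA] : exists n, ((1 - tau)%:E <= nu (A n))%E.
  apply/not_existsP => H.
  have : (nu (\bigcup_n A n) <= (1 - tau)%:E)%E.
    rewrite -(cvg_lim (@ereal_hausdorff R) cvgA); apply: lime_le.
      by apply/cvg_ex; eexists; exact: cvgA.
    by near=> n; have /negP := H n; rewrite -ltNge => /ltW.
  by rewrite nuU lee_fin; lra.
by exists n.+1%:R^-1.
Unshelve. all: by end_near. Qed.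

End real_intervals.

(** * Capacity of subintervals *)
Section capacity.
Context {R : realType}.
Implicit Types (X J : set R).

(** Robin's constant: the capacity is [exp] of its opposite. *)
Definition robin (A : set R[i]) : \bar R := ereal_inf [set log_energy mu | mu in prob_on A].

Lemma eq_robin (A B : set R[i]) : log_capacity A = log_capacity B -> robin A = robin B.
Proof. by move=> /expeR_inj /oppe_inj. Qed.

Lemma robin_le X J : measurable X -> measurable J -> X `<=` J ->
  (robin [set x%:C | x in J] <= robin [set x%:C | x in X])%E.
Proof.
move=> mX mJ XJ; apply: ereal_inf_le_tmp => _ [mu /= muX <-]; exists mu => //=.
apply: (subset_measure0 _ _ _ muX).
- by apply: measurableC; exact: measurable_image_real.
- by apply: measurableC; exact: measurable_image_real.
- by apply: subsetC; exact: image_subset.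
Qed.

Lemma measurable_set1_real (p : R) : measurable ([set p%:C] : set (borelC R)).
Proof.
by have := measurable_image_real [set p] (measurable_set1 p); rewrite image_set1.
Qed.

(** A probability on at most one point would have an atom, so its energy cannot
    be finite. *)
Lemma robin_subsingleton J (p : R) : measurable J -> J `<=` [set p] ->
  robin [set x%:C | x in J] = +oo%E.
Proof.
move=> mJ Jp; apply/eqP; rewrite -leye_eq; apply: le_ereal_inf_tmp => _ [mu muJ <-].
rewrite (log_energyE p 1 ltr01 mu J mJ _ muJ); last first.
  by move=> x /Jp ->; rewrite subrr normr0.
have [->|Efin] := eqVneq (energy (chart p 1) mu (fun=> 1%R)) +oo%E; first by [].
have mup : mu [set p%:C] = 0%E.
  apply: (energy_atom (chart p 1) (measurable_cos_chart p 1)).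
    exact: measurable_set1_real.
  by rewrite ltey.
pose B : set (borelC R) := (~` [set x%:C | x in J]) `|` [set p%:C].
have sub : setT `<=` B.
  move=> z _; have [[x Jx <-]|zJ] := pselect ([set x%:C | x in J] z); last by left.
  by right; rewrite /= (Jp x Jx).
have mJC : measurable (~` [set x%:C | x in J] : set (borelC R)).
  by apply: measurableC; exact: measurable_image_real.
have : mu setT = 0%E.
  apply: (subset_measure0 _ _ sub) => //.
  - by apply: measurableU => //; exact: measurable_set1_real.
  - by apply: null_set_setU => //; exact: measurable_set1_real.
have : mu setT = 1%E := probability_setT mu.
by move=> -> [] /eqP; rewrite oner_eq0.
Qed.

Lemma robin_interval_le J (c h : R) : 0 < h -> measurable J ->
  (forall x, J x -> `|x - c| <= h) -> (forall x, `|x - c| < h -> J x) ->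
  (robin [set x%:C | x in J] <= (ln 4 - ln (2 * h))%:E)%E.
Proof.
move=> h0 mJ Jc cJ; have [rho [Erho rhoJ]] := exists_arcsine_law c h h0.
apply: (@le_trans _ _ (log_energy rho)).
  by apply: ereal_inf_lbound; exists rho => //=; exact: rhoJ.
rewrite (log_energyE c h h0 rho J mJ Jc (rhoJ J mJ cJ)) EFinB.
by rewrite leeD2r.
Qed.

(** By convexity [(1 - y) ^ -2 <= 1 + 4 y] for [0 <= y <= 1 / 4]; here
    [y = 3 tau]. *)
Lemma normalization_loss (E e : R) : 0 <= E -> 0 < e -> exists tau, [/\ 0 < tau, tau < 4^-1 &
  (1 - 3 * tau) ^- 2 * (E + 2 * tau) <= E + e].
Proof.
move=> E0 e0; pose tau := Num.min (12^-1) (e / (12 * E + 4)).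
have d0 : 0 < 12 * E + 4 by lra.
have t0 : 0 < tau by rewrite lt_min divr_gt0// invr_gt0 ltr0n.
have t1 : tau <= 12^-1 by rewrite ge_min lexx.
have t2 : tau * (12 * E + 4) <= e by rewrite -ler_pdivlMr// ge_min lexx orbT.
exists tau; split => //; first by lra.
have s0 : 0 < (1 - 3 * tau) ^+ 2 by rewrite exprn_gt0//; lra.
rewrite mulrC ler_pdivrMr//.
have k : 1 <= (1 + 12 * tau) * (1 - 3 * tau) ^+ 2 by nra.
apply: (@le_trans _ _ ((E + 2 * tau) * ((1 + 12 * tau) * (1 - 3 * tau) ^+ 2))).
  by rewrite ler_peMr//; nra.
rewrite mulrA ler_pM2r//; nra.
Qed.

(** The transfer is applied with [B] the union of [J'] and of the complement of
    [J]: then the distance from [A] to the complement of [B] is a pointwise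
    condition on the angles, and a measure that charges neither the complement
    of [X] nor that of [B] lives on the intersection of [X] and [J']. *)
Lemma robin_subinterval_le X J J' (c h : R) : 0 < h ->
  measurable X -> measurable J -> X `<=` J ->
  (forall x, J x -> `|x - c| <= h) ->
  (robin [set x%:C | x in X] <= (ln 4 - ln (2 * h))%:E)%E ->
  is_interval J' -> J' `<=` J ->
  (robin [set x%:C | x in X `&` J'] <= robin [set x%:C | x in J'])%E.
Proof.
move=> h0 mX mJ XJ Jc robX iJ' J'J.
have mJ' : measurable J' by exact: is_interval_measurable.
have mth := measurable_cos_chart c h.
have near_eq n : exists mu : probability (borelC R) R,
    prob_on [set x%:C | x in X] mu /\
    (energy (chart c h) mu (fun=> 1%R) <= (ln 4 + n.+1%:R^-1)%:E)%E.
  have lt : (robin [set x%:C | x in X] < (ln 4 - ln (2 * h) + n.+1%:R^-1)%:E)%E.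
    by apply: (le_lt_trans robX); rewrite lte_fin ltrDl invr_gt0.
  have [_ [mu muX <-] Emu] := ereal_inf_lt lt; exists mu; split => //.
  move: Emu; rewrite (log_energyE c h h0 mu X mX _ muX); last first.
    by move=> x /XJ; exact: Jc.
  by rewrite lteBlDr// -EFinD => /ltW; rewrite addrAC subrK.
pose mu n := sval (cid (near_eq n)).
have muX n : prob_on [set x%:C | x in X] (mu n).
  by rewrite /mu; case: cid => ? [].
have Emu n : (energy (chart c h) (mu n) (fun=> 1%R) <= (ln 4 + n.+1%:R^-1)%:E)%E.
  by rewrite /mu; case: cid => ? [].
apply: le_ereal_inf_tmp => _ [nu nuJ' <-].
have J'c x : J' x -> `|x - c| <= h by move=> /J'J; exact: Jc.
rewrite (log_energyE c h h0 nu J' mJ' J'c nuJ').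
have [->|Efin] := eqVneq (energy (chart c h) nu (fun=> 1%R)) +oo%E.
  by rewrite leey.
have E0 : (0 <= energy (chart c h) nu (fun=> 1%R))%E.
  by apply: dint_ge0 => x y; rewrite mule_ge0 ?logker_ge0// lee_fin mulr1.
have Efn : energy (chart c h) nu (fun=> 1%R) \is a fin_num by rewrite ge0_fin_numE// ltey.
move: E0; rewrite -(fineK Efn) lee_fin; set E := fine _ => E0.
apply/lee_addgt0Pr => e e0.
have [tau [t0 t4 tauE]] := normalization_loss E e E0 e0.
have atom x : nu [set x%:C] = 0%E.
  apply: (energy_atom _ mth); first exact: measurable_set1_real.
  by rewrite ltey.
have J'0 : J' !=set0.
  apply/set0P/negP => /eqP J'0; have := nuJ'; rewrite /prob_on /= J'0 image_set0 setC0.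
  by rewrite [X in X = _ -> _](probability_setT nu) => -[] /eqP; rewrite oner_eq0.
have bJ' : bounded_set J'.
  exists (`|c| + h); split; first exact: num_real.
  move=> M cM x /J'c xc; apply: le_trans (ltW cM).
  by rewrite -lerBlDl (le_trans (lerB_dist _ _)).
have [a [b [J'ab abJ']]] := bounded_interval_ends J' iJ' bJ' J'0.
have [d d0 nuA] := inner_interval_mass nu J' a b tau mJ' J'ab nuJ' (atom a) (atom b) t0.
pose JC : set (borelC R) := [set x%:C | x in J].
pose B : set (borelC R) := [set x%:C | x in J'] `|` ~` JC.
have mJC : measurable JC by exact: measurable_image_real.
have mB : measurable B.
  apply: measurableU; first exact: measurable_image_real.
  exact: measurableC.
have mA : measurable ([set x%:C | x in `[(a + d)%R, (b - d)%R]] : set (borelC R)).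
  exact: measurable_image_real.
have AB z w : ~ B z -> [set x%:C | x in `[(a + d)%R, (b - d)%R]] w ->
    d / h <= `|cos (chart c h z) - cos (chart c h w)|.
  move=> Bz [y]; rewrite /= in_itv/= => /andP[y1 y2] <-.
  have [x Jx xz] : JC z by apply: contrapT => nJ; apply: Bz; right.
  have J'x : ~ J' x by move=> J'x; apply: Bz; left; exists x.
  have J'y : J' y by apply: abJ'; apply/andP; split; lra.
  rewrite -xz !cos_chart//; [|exact: J'c|exact: Jc].
  rewrite -mulrBl normrM normfV (gtr0_norm h0) ler_pM2r ?invr_gt0//.
  have -> : x - c - (y - c) = x - y by ring.
  apply: (dist_inner_interval a b) => //; apply/negP => axb.
  by apply: J'x; exact: abJ'.
have Enu : (energy (chart c h) nu (fun=> 1%R) <= E%:E)%E by rewrite /E fineK.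
have [n [nu' [nu'0 nu'B Enu']]] := near_equilibrium_transfer (chart c h) mth mu nu
  [set x%:C | x in `[(a + d)%R, (b - d)%R]] B (d / h) E tau Emu mA mB (divr_gt0 d0 h0) AB
  Enu t0 t4 nuA.
pose XC : set (borelC R) := [set x%:C | x in X].
have mXC : measurable XC by exact: measurable_image_real.
have mXJ' : measurable (X `&` J') by exact: measurableI.
have nu'X : nu' (~` [set x%:C | x in X `&` J']) = 0%E.
  have sub : (~` [set x%:C | x in X `&` J'] : set (borelC R)) `<=` ~` XC `|` ~` B.
    move=> z zXJ; have [[x Xx xz]|] := pselect (XC z); last by left.
    right => -[[y J'y yz]|nJ]; last by apply: nJ; exists x => //; exact: XJ.
    apply: zXJ; exists x => //; split => //.
    have [-> //] : x%:C = y%:C :> R[i] by rewrite xz yz.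
  apply: (subset_measure0 _ _ sub).
  - by apply: measurableC; exact: measurable_image_real.
  - by apply: measurableU; exact: measurableC.
  - apply: null_set_setU => //; [exact: measurableC|exact: measurableC|].
    by apply: nu'0; [exact: measurableC|exact: muX].
apply: (@le_trans _ _ (log_energy nu')); first by apply: ereal_inf_lbound; exists nu'.
rewrite (log_energyE c h h0 nu' (X `&` J') mXJ' _ nu'X); last first.
  by move=> x [_ /J'c].
apply: (@le_trans _ _ (((1 - 3 * tau) ^- 2 * (E + 2 * tau))%:E - (ln (2 * h))%:E)%E).
  exact: leeD2r.
by rewrite -!EFinN -!EFinD lee_fin addrAC lerD2r.
Qed.

End capacity.

Theorem proposition1p6 (R : realType) (J X : set R)
    (intJ : is_interval J) (bndJ : bounded_set J)
    (mX : measurable X) (XJ : X `<=` J)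
    (capXJ : log_capacity [set x%:C | x in X] = log_capacity [set x%:C | x in J]) :
  forall J' : set R, is_interval J' -> J' `<=` J ->
    log_capacity [set x%:C | x in X `&` J'] = log_capacity [set x%:C | x in J'].
Proof.
move=> J' iJ' J'J.
have mJ : measurable J by exact: is_interval_measurable.
have mJ' : measurable J' by exact: is_interval_measurable.
have mXJ' : measurable (X `&` J') by exact: measurableI.
suff E : robin [set x%:C | x in X `&` J'] = robin [set x%:C | x in J'].
  by rewrite /log_capacity -!/(robin _) E.
have ge : (robin [set x%:C | x in J'] <= robin [set x%:C | x in X `&` J'])%E.
  by apply: robin_le => // x [].
have [[p [q [J'p J'q pq]]]|single] := pselect (exists p q, [/\ J' p, J' q & p < q]); last first.
  have [p J'p] : exists p, J' `<=` [set p].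
    have [->|/set0P[p J'p]] := eqVneq J' set0; first by exists 0.
    exists p => q J'q; apply/eqP; rewrite eq_le !leNgt.
    by apply/andP; split; apply/negP => H; apply: single; [exists p, q|exists q, p].
  by apply/eqP; rewrite eq_le ge (robin_subsingleton J' p mJ' J'p) leey.
have J0 : J !=set0 by exists p; exact: J'J.
have [a [b [Jab abJ]]] := bounded_interval_ends J intJ bndJ J0.
have ab : a < b.
  by have /andP[? _] := Jab _ (J'J _ J'p); have /andP[_ ?] := Jab _ (J'J _ J'q); lra.
pose c := (a + b) / 2; pose h := (b - a) / 2.
have h0 : 0 < h by rewrite /h; lra.
have Jc x : J x -> `|x - c| <= h.
  by move=> /Jab /andP[? ?]; rewrite ler_norml /c /h; apply/andP; split; lra.
have cJ x : `|x - c| < h -> J x.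
  by rewrite ltr_norml /c /h => /andP[? ?]; apply: abJ; apply/andP; split; lra.
apply/eqP; rewrite eq_le ge andbT; apply: (robin_subinterval_le X J J' c h) => //.
rewrite (eq_robin _ _ capXJ); exact: (robin_interval_le J c h).
Qed.
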